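(* Let $A=kQ/I$ be a finite-dimensional gentle algebra over an algebraically closed field $k$, let $\mathcal S$ be the set of all strings over $A$, and let $w\in\mathcal S$. Then the string module $M(w)$ is exceptional if and only if $w$ does not have self-extensions, that is, if and only if the following conditions hold: (1) there does not exist $\alpha\in Q_1$ such that $w\alpha w\in\mathcal S$ or $w\alpha w^{-1}\in\mathcal S$; (2) there does not exist $\beta\in Q_1$ such that $w\beta^{-1}w\in\mathcal S$ or $w^{-1}\beta^{-1}w\in\mathcal S$; (3) $w$ only admits one-sided ad-pairs in $\mathfrak F(w)\times\mathfrak S(w)$.
   Context: A module $M$ is called exceptional if $\operatorname{Ext}^1_A(M,M)=0$. **Gentle algebra.** A finite-dimensional algebra $A$ over an algebraically closed field $k$ is gentle if there are a quiver $Q=(Q_0,Q_1)$ and an admissible ideal $I$ with $A=kQ/I$ such that: (G1) at each vertex start at most two arrows and stop at most two arrows; (G2) for each arrow $\alpha$ there is at most one arrow $\beta$ and at most one arrow $\delta$ with $\alpha\beta\notin I$ and $\delta\alpha\notin I$; (G3) $I$ is generated by paths of length 2; (G4) for each arrow $\alpha$ there is at most one arrow $\beta$ and at most one arrow $\delta$ with $\alpha\beta\in I$ and $\delta\alpha\in I$. In (G2) and (G4), $\alpha\beta$ and $\delta\alpha$ are paths of $Q$. Paths are written left to right: $\alpha\beta$ means first $\alpha$, then $\beta$. Modules are finite-dimensional representations of $Q$ satisfying the relations in $I$. **Strings.** For an arrow $\beta$, $s(\beta)$ and $e(\beta)$ are its start and end; the formal inverse $\beta^{-1}$ has $s(\beta^{-1})=e(\beta)$,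 $e(\beta^{-1})=s(\beta)$. A string of length $n\ge 1$ is a word $w=\alpha_1\cdots\alpha_n$ of arrows and formal inverses of arrows with $\alpha_{i+1}\ne\alpha_i^{-1}$ and $e(\alpha_i)=s(\alpha_{i+1})$ for $1\le i\le n-1$, such that no subword nor its inverse is in $I$. Its length is $l(w)=n$. For each vertex $x$ there are two strings $1_{x^{+1}},1_{x^{-1}}$ of length 0, with start and end $x$ and $(1_{x^{t}})^{-1}=1_{x^{-t}}$. $\mathcal S$ denotes the set of all strings. Concatenation with length-zero strings uses sign functions: fix $\sigma,\varepsilon:Q_1\to\{1,-1\}$ such that distinct arrows with the same start have opposite $\sigma$, distinct arrows with the same end have opposite $\varepsilon$, and for arrows $\gamma,\beta$ with $e(\gamma)=s(\beta)$ one has $\sigma(\beta)=-\varepsilon(\gamma)$ if $\gamma\beta\notin I$ and $\sigma(\beta)=\varepsilon(\gamma)$ if $\gamma\beta\in I$. Put $\sigma(\alpha^{-1})=\varepsilon(\alpha)$, $\varepsilon(\alpha^{-1})=\sigma(\alpha)$, $\sigma(\alpha_1\cdots\alpha_n)=\sigma(\alpha_1)$, $\varepsilon(\alpha_1\cdots\alpha_n)=\varepsilon(\alpha_n)$, $\sigma(1_{x^t})=t$, $\varepsilon(1_{x^t})=-t$. If $u$ or $u'$ has length 0, the product $uu'$ is defined iff $e(u)=s(u')$ and $\sigma(u')=-\varepsilon(u)$, and it is then the other factor. **String modules.** For a string $w=\alpha_1\cdots\alpha_n$, viewed as a walk through vertices $e_1,\dots,e_{n+1}$, the string module $M(w)$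 has basis $z_1,\dots,z_{n+1}$ with $z_i$ at vertex $e_i$; if $\alpha_i\in Q_1$ then $\alpha_i$ sends $z_i$ to $z_{i+1}$; if $\alpha_i^{-1}\in Q_1$ then $\alpha_i^{-1}$ sends $z_{i+1}$ to $z_i$; all other actions of arrows on basis vectors are zero. For $w$ of length 0 at $x$, $M(w)$ is the simple module at $x$. **Factor strings, substrings, ad-pairs.** Let $w\in\mathcal S$ and $w=DEF$ with $D,E,F\in\mathcal S$. The triple $(D,E,F)$ is a factor string of $w$ if ($l(D)=0$ or the last letter of $D$ is the inverse of an arrow) and ($l(F)=0$ or the first letter of $F$ is an arrow). It is a substring of $w$ if ($l(D)=0$ or the last letter of $D$ is an arrow) and ($l(F)=0$ or the first letter of $F$ is the inverse of an arrow). $\mathfrak F(w)$ and $\mathfrak S(w)$ denote the sets of factor strings and substrings of $w$. An ad-pair in $\mathfrak F(v)\times\mathfrak S(w)$ is a pair $(D,E,F)\times(D',E',F')$ in this set with $E=E'$ or $E^{-1}=E'$. It is one-sided if either $E=E'$ and ($l(D)=l(D')=0$ or $l(F)=l(F')=0$), or $E^{-1}=E'$ and ($l(D)=l(F')=0$ or $l(F)=l(D')=0$). It is two-sided if it is not one-sided. **Self-extensions.** Strings $w,v$ have extensions from $w$ to $v$ if one of the following holds: (E1) there is $\alpha\in Q_1$ such that $w\alpha v$ or $w\alpha v^{-1}$ is a string; (E2) there is $\beta\in Q_1$ such that $w^{-1}\beta v$ or $w^{-1}\beta v^{-1}$ is a string; (E3) $w,v$ admit a two-sided ad-pair in $\mathfrak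 F(v)\times\mathfrak S(w)$. A string $w$ has self-extensions if this holds with $v=w$. *)

(* Defs.v *)
From HB Require Import structures.
From mathcomp Require Import all_boot all_order all_algebra.
From mathcomp Require Import finmap monalg.

Set Implicit Arguments.
Unset Strict Implicit.
Unset Printing Implicit Defensive.

Import GRing.Theory.
Local Open Scope ring_scope.

(* Paths are written left to right: in [:: a; b] the arrow a comes first.     *)

(* Finiteness of the quiver is no restriction: if I is admissible and kQ/I is *)
(* a finite-dimensional unital algebra, the vertices and the arrows are       *)
(* linearly independent modulo I.                                             *)
Record quiver := Quiver {
  vertex : finType;
  arrow : finType;
  src : arrow -> vertex;
  tgt : arrow -> vertex }.

Arguments src {q}.
Arguments tgt {q}.

Section PathAlgebra.
Variable Q : quiver.

Fixpoint is_path (x : vertex Q) (s : seq (arrow Q)) : bool :=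
  if s is a :: s' then (src a == x) && is_path (tgt a) s' else true.

(* A path is a start vertex together with a composable sequence of arrows;    *)
(* (x, [::]) is the trivial path at x.                                        *)
Definition qpath := {p : vertex Q * seq (arrow Q) | is_path p.1 p.2}.

Definition pstart (p : qpath) : vertex Q := (val p).1.
Definition parrows (p : qpath) : seq (arrow Q) := (val p).2.
Definition pend (p : qpath) : vertex Q := last (pstart p) (map tgt (parrows p)).

Definition pcat (p q : qpath) : option qpath :=
  if pend p == pstart q
  then insub (pstart p, parrows p ++ parrows q) : option qpath else None.

Variable k : fieldType.

Definition path_algebra := {malg k[qpath]}.

Definition pbasis (p : qpath) : path_algebra := << p >>.

Definition pa_mul (f g : path_algebra) : path_algebra :=
  \sum_(p <- msupp f) \sum_(q <- msupp g)
    (f@_p * g@_q) *: oapp pbasis 0 (pcat p q).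

Definition two_sided_ideal (I : path_algebra -> Prop) : Prop :=
  [/\ I 0,
      forall (c : k) f g, I f -> I g -> I (c *: f + g),
      forall f g, I f -> I (pa_mul f g) &
      forall f g, I g -> I (pa_mul f g)].

Definition ideal_generated_by (P : qpath -> Prop) (f : path_algebra) : Prop :=
  forall J, two_sided_ideal J -> (forall p, P p -> J (pbasis p)) -> J f.

(* The m-th power of the ideal generated by the arrows.                       *)
Definition arrow_ideal_pow (m : nat) (f : path_algebra) : Prop :=
  forall p, p \in msupp f -> (m <= size (parrows p))%N.

Definition admissible (I : path_algebra -> Prop) : Prop :=
  [/\ two_sided_ideal I,
      exists2 m, (2 <= m)%N & forall f, arrow_ideal_pow m f -> I f &
      forall f, I f -> arrow_ideal_pow 2 f].

(* For s nonempty: s is a path of Q that lies in I.                           *)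
Definition arrows_in (I : path_algebra -> Prop) (s : seq (arrow Q)) : Prop :=
  exists2 p : qpath, parrows p = s & I (pbasis p).

Record gentle (I : path_algebra -> Prop) : Prop := Gentle {
  gentle_admissible : admissible I;
  gentle_out : forall x, (#|[set a : arrow Q | src a == x]| <= 2)%N;
  gentle_in : forall x, (#|[set a : arrow Q | tgt a == x]| <= 2)%N;
  gentle_nonrel_r : forall a b b' : arrow Q,
    tgt a = src b -> tgt a = src b' ->
    ~ arrows_in I [:: a; b] -> ~ arrows_in I [:: a; b'] -> b = b';
  gentle_nonrel_l : forall a d d' : arrow Q,
    tgt d = src a -> tgt d' = src a ->
    ~ arrows_in I [:: d; a] -> ~ arrows_in I [:: d'; a] -> d = d';
  gentle_length2 : exists2 P : qpath -> Prop,
    (forall p, P p -> size (parrows p) = 2%N) &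
    (forall f, I f <-> ideal_generated_by P f);
  gentle_rel_r : forall a b b' : arrow Q,
    tgt a = src b -> tgt a = src b' ->
    arrows_in I [:: a; b] -> arrows_in I [:: a; b'] -> b = b';
  gentle_rel_l : forall a d d' : arrow Q,
    tgt d = src a -> tgt d' = src a ->
    arrows_in I [:: d; a] -> arrows_in I [:: d'; a] -> d = d' }.

(* The sign 1 is encoded as true, -1 as false.                                *)
Record sign_functions (I : path_algebra -> Prop)
    (sigma eps : arrow Q -> bool) : Prop := SignFunctions {
  sign_src : forall a b, a != b -> src a = src b -> sigma a = ~~ sigma b;
  sign_tgt : forall a b, a != b -> tgt a = tgt b -> eps a = ~~ eps b;
  sign_nonrel : forall c b, tgt c = src b ->
    ~ arrows_in I [:: c; b] -> sigma b = ~~ eps c;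
  sign_rel : forall c b, tgt c = src b ->
    arrows_in I [:: c; b] -> sigma b = eps c }.

End PathAlgebra.

Section Representations.
Variables (Q : quiver) (k : fieldType).

Record rep := Rep {
  rep_space :> vertex Q -> vectType k;
  rep_map : forall a : arrow Q, 'Hom(rep_space (src a), rep_space (tgt a)) }.

(* Right action of kQ on the direct sum of the spaces M x, whose elements are *)
(* the families m : forall x, M x.                                            *)
Definition act_arrow (M : rep) (m : forall x, M x) (a : arrow Q) :
    forall y, M y := fun y =>
  if tgt a =P y is ReflectT e then ecast z (M z) e (rep_map M a (m (src a)))
  else 0.

Definition act_path (M : rep) (m : forall x, M x) (p : qpath Q) :
    forall y, M y :=
  foldl (@act_arrow M) (fun y => if y == pstart p then m y else 0) (parrows p).

Definition act (M : rep) (m : forall x, M x) (f : path_algebra Q k) :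
    forall y, M y :=
  fun y => \sum_(p <- msupp f) f@_p *: act_path m p y.

Variable I : path_algebra Q k -> Prop.

Definition is_module (M : rep) : Prop :=
  forall f, I f -> forall (m : forall x, M x) y, act m f y = 0.

Record rep_hom (M N : rep) := RepHom {
  hom_map :> forall x, 'Hom(M x, N x);
  hom_comm : forall a,
    (rep_map N a \o hom_map (src a) = hom_map (tgt a) \o rep_map M a)%VF }.

(* Short exact sequences 0 -> N -> E -> M -> 0 of kQ/I-modules.               *)
Record extension (M N : rep) := Extension {
  ext_mid : rep;
  ext_mid_module : is_module ext_mid;
  ext_inj : rep_hom N ext_mid;
  ext_proj : rep_hom ext_mid M;
  ext_inj_ker : forall x, lker (ext_inj x) = 0%VS;
  ext_exact : forall x, limg (ext_inj x) = lker (ext_proj x);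
  ext_proj_img : forall x, limg (ext_proj x) = fullv }.

Definition ext_equiv (M N : rep) (X Y : extension M N) : Prop :=
  exists phi : rep_hom (ext_mid X) (ext_mid Y), forall x,
    (phi x \o ext_inj X x = ext_inj Y x)%VF /\
    (ext_proj Y x \o phi x = ext_proj X x)%VF.

(* Ext^1(M, N) is Yoneda's group of extensions modulo equivalence, with the   *)
(* class of the split extension as zero; it vanishes iff there is only one    *)
(* class.                                                                     *)
Definition Ext1_zero (M N : rep) : Prop :=
  forall X Y : extension M N, ext_equiv X Y.

Definition exceptional (M : rep) : Prop := is_module M /\ Ext1_zero M M.

End Representations.

Section Strings.
Variable Q : quiver.

(* (true, a) is the arrow a, (false, a) is its formal inverse.                *)
Definition letter := (bool * arrow Q)%type.

Definition linv (l : letter) : letter := (~~ l.1, l.2).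
Definition lstart (l : letter) : vertex Q := if l.1 then src l.2 else tgt l.2.
Definition lend (l : letter) : vertex Q := if l.1 then tgt l.2 else src l.2.

(* Triv x t is 1_{x^t}; Word l ls is the nonempty word with first letter l.   *)
Inductive word :=
| Triv of vertex Q & bool
| Word of letter & seq letter.

Definition letters (w : word) : seq letter :=
  if w is Word l ls then l :: ls else [::].

Definition wlen (w : word) : nat := size (letters w).

Definition wstart (w : word) : vertex Q :=
  match w with Triv x _ => x | Word l _ => lstart l end.

Definition wend (w : word) : vertex Q :=
  match w with Triv x _ => x | Word l ls => lend (last l ls) end.

Definition winv (w : word) : word :=
  match w with
  | Triv x t => Triv x (~~ t)
  | Word l ls => Word (linv (last l ls)) (map linv (rev (belast l ls)))
  end.

Definition warrow (a : arrow Q) : word := Word (true, a) [::].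
Definition warrow_inv (a : arrow Q) : word := Word (false, a) [::].

Variables (k : fieldType) (I : path_algebra Q k -> Prop).

Definition is_string (w : word) : Prop :=
  sorted (fun l l' => (lend l == lstart l') && (l' != linv l)) (letters w) /\
  forall u v u' : seq letter, letters w = u ++ v ++ u' ->
    forall s : seq (arrow Q), arrows_in I s ->
      v <> map (pair true) s /\ map linv (rev v) <> map (pair true) s.

Variables sigma eps : arrow Q -> bool.

Definition wsigma (w : word) : bool :=
  match w with
  | Triv _ t => t
  | Word l _ => if l.1 then sigma l.2 else eps l.2
  end.

Definition weps (w : word) : bool :=
  match w with
  | Triv _ t => ~~ t
  | Word l ls => let m := last l ls in if m.1 then eps m.2 else sigma m.2
  end.

Definition wcat (u v : word) : option word :=
  match u, v with
  | Word l ls, Word m ms => Some (Word l (ls ++ m :: ms))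
  | _, _ =>
      if (wend u == wstart v) && (wsigma v == ~~ weps u)
      then Some (if u is Triv _ _ then v else u) else None
  end.

Definition wcat3 (u v w : word) : option word := obind (wcat^~ w) (wcat u v).

(* The product uvw is defined and is a string.                                *)
Definition cat3_string (u v w : word) : Prop :=
  exists2 x, wcat3 u v w = Some x & is_string x.

Definition ends_direct (w : word) : bool :=
  if w is Word l ls then (last l ls).1 else true.
Definition ends_inverse (w : word) : bool :=
  if w is Word l ls then ~~ (last l ls).1 else true.
Definition starts_direct (w : word) : bool :=
  if w is Word l _ then l.1 else true.
Definition starts_inverse (w : word) : bool :=
  if w is Word l _ then ~~ l.1 else true.

Definition decomposition (w D E F : word) : Prop :=
  [/\ is_string D, is_string E, is_string F & wcat3 D E F = Some w].

Definition factor_string (w D E F : word) : Prop :=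
  [/\ decomposition w D E F, ends_inverse D & starts_direct F].

Definition substring (w D E F : word) : Prop :=
  [/\ decomposition w D E F, ends_direct D & starts_inverse F].

(* ((D, E, F), (D', E', F')) is an ad-pair in F(v) x S(w).                    *)
Definition ad_pair (v w D E F D' E' F' : word) : Prop :=
  [/\ factor_string v D E F, substring w D' E' F' & E = E' \/ winv E = E'].

Definition one_sided (D E F D' E' F' : word) : Prop :=
  (E = E' /\ ((wlen D = 0%N /\ wlen D' = 0%N) \/
              (wlen F = 0%N /\ wlen F' = 0%N))) \/
  (winv E = E' /\ ((wlen D = 0%N /\ wlen F' = 0%N) \/
                   (wlen F = 0%N /\ wlen D' = 0%N))).

Definition have_extensions (w v : word) : Prop :=
  [\/ exists a, cat3_string w (warrow a) v \/
                cat3_string w (warrow a) (winv v),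
      exists b, cat3_string (winv w) (warrow b) v \/
                cat3_string (winv w) (warrow b) (winv v) |
      exists D E F D' E' F',
        ad_pair v w D E F D' E' F' /\ ~ one_sided D E F D' E' F'].

Definition has_self_extensions (w : word) : Prop := have_extensions w w.

End Strings.

Section StringModule.
Variables (Q : quiver) (k : fieldType) (w : word Q).

(* The basis vectors z_0, ..., z_n (with n the length of w) are indexed by    *)
(* 'I_n.+1, and the letter of index i joins z_i and z_{i+1}.                  *)
Definition wvertex (i : 'I_(wlen w).+1) : vertex Q :=
  nth (wstart w) (wstart w :: map (@lend Q) (letters w)) i.

Definition sends (a : arrow Q) (i j : 'I_(wlen w).+1) : bool :=
  (j == i.+1 :> nat) && (onth (letters w) i == Some (true, a)) ||
  (i == j.+1 :> nat) && (onth (letters w) j == Some (false, a)).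

Definition smod_basis (x : vertex Q) := {i : 'I_(wlen w).+1 | wvertex i == x}.

(* f : smod_space x stands for the linear combination \sum_i f i *: z_i.      *)
Definition smod_space (x : vertex Q) : vectType k := {ffun smod_basis x -> k^o}.

Definition smod_fun (a : arrow Q) (f : smod_space (src a)) :
    smod_space (tgt a) :=
  [ffun j => \sum_(i | sends a (val i) (val j)) f i].

Fact smod_fun_is_linear a : linear (@smod_fun a).
Proof.
move=> c f g; apply/ffunP=> j; rewrite !ffunE scaler_sumr -big_split.
by apply: eq_bigr => i _; rewrite !ffunE.
Qed.

HB.instance Definition _ a :=
  GRing.isLinear.Build k (smod_space (src a)) (smod_space (tgt a)) _
    (@smod_fun a) (@smod_fun_is_linear a).

Definition string_module : rep Q k :=
  @Rep Q k smod_space (fun a => linfun (@smod_fun a)).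

End StringModule.

(* Main.v *)
Require Import Defs.
From HB Require Import structures.
From mathcomp Require Import all_boot all_order all_algebra.
From mathcomp Require Import finmap monalg zify.

Set Implicit Arguments.
Unset Strict Implicit.
Unset Printing Implicit Defensive.

Import GRing.Theory.
Local Open Scope ring_scope.

(* A self-extension of M = M(w) is given by a cocycle: matrices D a with      *)
(* S a * D b + D a * S b = 0 for every relation ab, where S a is the matrix   *)
(* of a on M in the basis (z_i) and vectors are rows. It splits iff           *)
(* D a = H * S a - S a * H for some H preserving the vertices.                *)
(*                                                                            *)
(* Each coboundary equation (a, i, j) involves at most two entries of H, so   *)
(* the pairs (i, j) of positions at a common vertex form a graph: (i, j) is   *)
(* joined to (i', j') if the same letter leads from i to i' and from j to j'. *)
(* Every position has two sides, told apart by the sign functions, with at    *)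
(* most one letter on each. Hence the graph is a disjoint union of paths,     *)
(* namely the maximal common subwords of w and w or its inverse. An end of    *)
(* such a path may carry an equation that prescribes H there; a cocycle can   *)
(* then be solved for H along the path unless this happens at both ends, and  *)
(* those paths are the two-sided ad-pairs. The only remaining equations are   *)
(* those that involve no entry of H and no relation; they are the pairs of    *)
(* ends of w that can be joined by an arrow.                                  *)

(** * Modules over the path algebra *)

(** Self-extensions of $M(w)$ are cocycles modulo coboundaries ([Ext1_zeroP]), and the standard
    basis turns them into matrices indexed by pairs of positions ([exceptional_mxP]). The
    combinatorics is local: by [is_stringP] the signs alone decide which letters may follow each
    other. Two obstructions can occur. A coordinate [(a, i, j)] that meets no cocycle equation and
    no entry of [H] carries a cocycle that is not a coboundary ([isolated_not_coboundary]); by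
    [isolatedP] such coordinates are the arrow extensions (E1) and (E2). A path of the pair graph
    with [H] prescribed at both ends, a [bad_chain], receives two prescriptions that a cocycle need
    not reconcile ([bad_chain_not_coboundary]); the word read along it is the middle string of a
    two-sided ad-pair ([one_sided_or_bad_chain], [ad_pair_of_bad_chain]). If neither occurs,
    [mxcocycle_coboundary] solves for [H]. *)

Section LinearExtension.
Variables (K : choiceType) (k : fieldType) (V : lmodType k).

Definition lin_ext (F : K -> V) (f : {malg k[K]}) : V :=
  \sum_(p <- msupp f) f@_p *: F p.

(** Terms outside the support vanish; a common index set for several elements makes linearity a
    termwise statement. *)
Lemma lin_extEw F (d : {fset K}) f :
  (msupp f `<=` d)%fset -> lin_ext F f = \sum_(p <- d) f@_p *: F p.
Proof.
move=> le; rewrite /lin_ext; apply/big_fset_incl => // p _ /mcoeff_outdom ->.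
by rewrite scale0r.
Qed.

Lemma lin_ext_linear F c f g :
  lin_ext F (c *: f + g) = c *: lin_ext F f + lin_ext F g.
Proof.
pose d := (msupp (c *: f + g) `|` (msupp f `|` msupp g))%fset.
have s1 : (msupp (c *: f + g) `<=` d)%fset by apply: fsubsetUl.
have s2 : (msupp f `<=` d)%fset by rewrite fsubsetU // fsubsetUl orbT.
have s3 : (msupp g `<=` d)%fset by rewrite fsubsetU // fsubsetUr orbT.
rewrite (lin_extEw _ s1) (lin_extEw _ s2) (lin_extEw _ s3).
rewrite scaler_sumr -big_split /=; apply: eq_bigr => p _.
by rewrite mcoeffD mcoeffZ scalerDl scalerA.
Qed.

Lemma lin_ext0 F : lin_ext F 0 = 0.
Proof. by rewrite /lin_ext msupp0 big_seq_fset0. Qed.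

Lemma lin_extZ F c f : lin_ext F (c *: f) = c *: lin_ext F f.
Proof. by rewrite -[c *: f]addr0 lin_ext_linear lin_ext0 addr0. Qed.

Lemma lin_ext_sum F T (r : seq T) (f : T -> {malg k[K]}) :
  lin_ext F (\sum_(t <- r) f t) = \sum_(t <- r) lin_ext F (f t).
Proof.
elim: r => [|t r IH]; first by rewrite !big_nil lin_ext0.
by rewrite !big_cons -IH -[f t]scale1r lin_ext_linear !scale1r.
Qed.

Lemma lin_extU F p : lin_ext F << p >> = F p.
Proof. by rewrite /lin_ext msuppU oner_eq0 big_seq_fset1 mcoeffUU scale1r. Qed.

End LinearExtension.

Section PathActions.
Variables (Q : quiver) (k : fieldType).
Implicit Types (p q : qpath Q) (M : rep Q k).

(** Elements of a module are dependent functions and are compared pointwise; this congruence and the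
    next two allow rewriting under an action. *)
Lemma act_arrow_ext M (m m' : forall x, M x) a :
  (forall x, m x = m' x) -> forall y, act_arrow m a y = act_arrow m' a y.
Proof. by move=> eq y; rewrite /act_arrow; case: eqP => // e; rewrite eq. Qed.

Lemma foldl_act_ext M s (m m' : forall x, M x) :
  (forall x, m x = m' x) ->
  forall y, foldl (@act_arrow Q k M) m s y = foldl (@act_arrow Q k M) m' s y.
Proof.
elim: s m m' => //= a s IH m m' eq y; apply: IH => z.
exact: act_arrow_ext.
Qed.

Lemma act_path_ext M (m m' : forall x, M x) p :
  (forall x, m x = m' x) -> forall y, act_path m p y = act_path m' p y.
Proof. by move=> eq; apply: foldl_act_ext => x; rewrite eq. Qed.



Lemma ecast_linear (T : Type) (V : T -> vectType k) x y (e : x = y) c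
    (u v : V x) :
  ecast z (V z) e (c *: u + v) = c *: ecast z (V z) e u + ecast z (V z) e v.
Proof. by case: y / e. Qed.

Lemma act_arrow_linear M (m m' : forall x, M x) c a y :
  act_arrow (fun x => c *: m x + m' x) a y =
  c *: act_arrow m a y + act_arrow m' a y.
Proof.
rewrite /act_arrow; case: eqP => [e|_]; last by rewrite scaler0 addr0.
by rewrite linearP ecast_linear.
Qed.

Lemma act_path_linear M (m m' : forall x, M x) c p y :
  act_path (fun x => c *: m x + m' x) p y =
  c *: act_path m p y + act_path m' p y.
Proof.
have foldl_linear s (n n' : forall x, M x) :
    foldl (@act_arrow Q k M) (fun x => c *: n x + n' x) s y =
    c *: foldl (@act_arrow Q k M) n s y + foldl (@act_arrow Q k M) n' s y.
  elim: s n n' => //= a s IH n n'; rewrite -IH.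
  by apply: foldl_act_ext => x; apply: act_arrow_linear.
rewrite /act_path -foldl_linear; apply: foldl_act_ext => x.
by case: eqP => //; rewrite scaler0 addr0.
Qed.

Lemma act_path0 M (m : forall x, M x) p y :
  (forall x, m x = 0) -> act_path m p y = 0.
Proof.
move=> m0.
(* The zero family [m] agrees pointwise with [-1 *: m + m], on which the action cancels. *)
have := act_path_linear m m (-1) p y; rewrite scaleN1r addNr => <-.
by apply: act_path_ext => x; rewrite m0 scaler0 addr0.
Qed.

Lemma act_path_sum M T (r : seq T) (c : T -> k) (m : T -> forall x, M x) p y :
  act_path (fun x => \sum_(t <- r) c t *: m t x) p y =
  \sum_(t <- r) c t *: act_path (m t) p y.
Proof.
elim: r => [|t r IH].
  by rewrite big_nil; apply: act_path0 => x; rewrite big_nil.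
rewrite big_cons -IH -act_path_linear; apply: act_path_ext => x.
by rewrite big_cons.
Qed.

Lemma act_path_supp M (m : forall x, M x) p y :
  y != pend p -> act_path m p y = 0.
Proof.
have foldl_supp s x (n : forall z, M z) : (forall z, z != x -> n z = 0) ->
    y != last x (map tgt s) -> foldl (@act_arrow Q k M) n s y = 0.
  elim: s x n => [|a s IH] x n n0 /=; first exact: n0.
  by apply: IH => z; rewrite /act_arrow eq_sym; case: eqP.
by apply: foldl_supp => z /negPf ->.
Qed.

(** Acting by [p] lands at the end of [p]. If [q] starts elsewhere, both sides vanish: a product of
    paths that do not meet is zero, the default of [oapp]. *)
Lemma act_path_cat M (m : forall x, M x) p q y :
  act_path (act_path m p) q y = oapp (act_path m ^~ y) 0 (pcat p q).
Proof.
rewrite /pcat; have [e|ne] := eqVneq; last first.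
  rewrite {1}/act_path /= -[RHS](@act_path0 _ (fun=> 0) q y) // {2}/act_path.
  apply: foldl_act_ext => x; case: eqP => // ->.
  by apply: act_path_supp; rewrite eq_sym.
have pq : is_path (pstart p) (parrows p ++ parrows q).
  have := valP q; have := valP p; rewrite -!/(parrows _) -!/(pstart _) -e /pend.
  elim: (parrows p) (pstart p) => //= a s IH x /andP[-> ps] qs /=.
  exact: IH.
rewrite insubT /= {3}/act_path /parrows /pstart SubK /= foldl_cat.
apply: foldl_act_ext => x; case: eqP => // /eqP nx; symmetry.
by apply: act_path_supp; rewrite e.
Qed.

Lemma actE M (m : forall x, M x) f y :
  act m f y = lin_ext (fun p => act_path m p y) f.
Proof. by []. Qed.

Lemma act_pa_mul M (m : forall x, M x) f g y :
  act m (pa_mul f g) y = act (act m f) g y.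
Proof.
rewrite actE /pa_mul lin_ext_sum.
under eq_bigr => p _ do rewrite lin_ext_sum.
rewrite exchange_big; apply: eq_bigr => q _.
rewrite (act_path_sum _ (fun p => f@_p) (fun p => act_path m p)) scaler_sumr.
apply: eq_bigr => p _; rewrite lin_extZ mulrC scalerA act_path_cat.
by congr (_ *: _); case: pcat => [r|] /=; [rewrite lin_extU | rewrite lin_ext0].
Qed.

(** Because of this, [I] annihilates a representation as soon as its generators do. *)
Lemma annihilator_ideal M :
  two_sided_ideal (fun f => forall (m : forall x, M x) y, act m f y = 0).
Proof.
split=> [m y|c f g f0 g0 m y|f g f0 m y|f g g0 m y].
- by rewrite actE lin_ext0.
- by rewrite actE lin_ext_linear -!actE f0 g0 scaler0 addr0.
- rewrite act_pa_mul actE /lin_ext big1 // => p _.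
  by rewrite act_path0 ?scaler0.
- by rewrite act_pa_mul.
Qed.

(** * Ideals generated by paths of length two *)

Definition has_subpath2 (P : qpath Q -> Prop) p :=
  exists q, [/\ P q, size (parrows q) = 2 & infix (parrows q) (parrows p)].

Lemma mem_msupp_lin_ext (F : qpath Q -> path_algebra Q k) f p :
  p \in msupp (lin_ext F f) -> exists2 q, q \in msupp f & p \in msupp (F q).
Proof.
suff gen (r : seq (qpath Q)) : p \in msupp (\sum_(q <- r) f@_q *: F q) ->
    exists2 q, q \in r & p \in msupp (F q) by exact: gen.
elim: r => [|q r IH]; first by rewrite big_nil msupp0 inE.
rewrite big_cons => /(fsubsetP (msuppD_le _ _)).
rewrite in_fsetU => /orP[/(fsubsetP (msuppZ_le _ _)) h|/IH[x xr h]].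
  by exists q; rewrite ?mem_head.
by exists x; rewrite // inE xr orbT.
Qed.

Lemma mem_msupp_pa_mul f g r :
  r \in msupp (pa_mul f g : path_algebra Q k) ->
  exists p q, [/\ p \in msupp f, q \in msupp g & pcat p q = Some r].
Proof.
have -> : pa_mul f g = lin_ext (fun p =>
    lin_ext (fun q => oapp (@pbasis Q k) 0 (pcat p q)) g) f.
  rewrite /pa_mul; apply: eq_bigr => p _; rewrite scaler_sumr.
  by apply: eq_bigr => q _; rewrite scalerA.
move=> /mem_msupp_lin_ext[p pf /mem_msupp_lin_ext[q qg]].
case e: (pcat p q) => [s|] /=; last by rewrite msupp0 inE.
by rewrite msuppU oner_eq0 inE => /eqP ->; exists p, q.
Qed.

Lemma pcat_arrows p q r : pcat p q = Some r -> parrows r = parrows p ++ parrows q.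
Proof.
rewrite /pcat; case: eqP => // _; case: insubP => // s _ es [<-].
by rewrite /parrows es.
Qed.

(** Multiplication only prolongs paths, so a subpath survives in every path of a product. This ideal
    therefore contains the one generated by paths of length two in [P]. *)
Lemma subpath_ideal (P : qpath Q -> Prop) :
  two_sided_ideal (fun f : path_algebra Q k =>
    forall p, p \in msupp f -> has_subpath2 P p).
Proof.
split=> [p|c f g f0 g0 p|f g f0 r|f g g0 r].
- by rewrite msupp0 inE.
- move=> /(fsubsetP (msuppD_le _ _)); rewrite in_fsetU => /orP[|/g0 //].
  by move=> /(fsubsetP (msuppZ_le _ _)) /f0.
- move=> /mem_msupp_pa_mul[p [q [/f0[s [Ps s2 sp]] _ /pcat_arrows e]]].
  by exists s; split=> //; rewrite e infix_catr.
- move=> /mem_msupp_pa_mul[p [q [_ /g0[s [Ps s2 sp]] /pcat_arrows e]]].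
  by exists s; split=> //; rewrite e infix_catl.
Qed.

Variable I : path_algebra Q k -> Prop.
Hypothesis I2 : exists2 P : qpath Q -> Prop,
    (forall p, P p -> size (parrows p) = 2%N) &
    (forall f, I f <-> ideal_generated_by P f).

(** A path is its own support, so lying in the ideal of [subpath_ideal] forces the path itself to
    contain a generator. *)
Lemma arrows_in_subpath2 s :
  arrows_in I s -> exists a b, arrows_in I [:: a; b] /\ infix [:: a; b] s.
Proof.
case: I2 => P P2 IP [p <- /IP Ip].
have [||] := Ip _ (subpath_ideal P) _ p.
- move=> q Pq r; rewrite msuppU oner_eq0 inE => /eqP ->.
  by exists q; split=> //; [apply: P2 | apply: infix_refl].
- by rewrite msuppU oner_eq0 inE.
move=> q [Pq q2 qp]; case pq: (parrows q) q2 qp => [|a [|b []]] // _ qp.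
exists a, b; split=> //; exists q => //.
by apply/IP => J _; apply.
Qed.

Lemma is_moduleP M : is_module I M <->
  forall a b (e : tgt a = src b), arrows_in I [:: a; b] ->
  forall u, rep_map M b (ecast z (M z) e (rep_map M a u)) = 0.
Proof.
split=> [Mmod a b e [p pab Ip] u|M2 f If].
  (* [u] is placed at the source of [a], with zero at all other vertices; acting on it by the path
     [ab] gives the wanted composite. *)
  pose m x : M x := if src a =P x is ReflectT e then ecast z (M z) e u else 0.
  have := Mmod _ Ip m (tgt b); rewrite actE lin_extU /act_path pab /=.
  have ->: pstart p = src a.
    by have := valP p; rewrite -/(parrows p) -/(pstart p) pab /= => /andP[/eqP].
  rewrite /act_arrow; case: eqP => // e1; rewrite (eq_axiomK e1) /=.
  case: eqP => // e2; rewrite (eq_irrelevance e2 e) eqxx /m.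
  by case: eqP => // e3; rewrite (eq_axiomK e3) /=.
case: I2 => P P2 IP; move/IP: If => If.
apply: (If _ (annihilator_ideal M)) => p Pp m y; rewrite actE lin_extU /act_path.
have Ip : I (pbasis k p) by apply/IP => J _; apply.
case pab: (parrows p) (P2 _ Pp) => [|a [|b []]] // _ /=.
rewrite /act_arrow; case: eqP => // eb; case: eqP => [ea|_]; last first.
  by rewrite linear0; case: y / eb.
by rewrite M2; [case: y / eb | exists p].
Qed.

End PathActions.

(** * Extensions and cocycles *)

Section LinearFunctions.
Variables (k : fieldType) (aT rT : vectType k) (f : aT -> rT).
Hypothesis linear_f : linear f.

Definition lfun_of : 'Hom(aT, rT) :=
  let g : {linear aT -> rT} :=
    HB.pack f (GRing.isLinear.Build k aT rT _ f linear_f) in linfun g.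

Lemma lfun_ofE u : lfun_of u = f u.
Proof. by rewrite lfunE. Qed.

End LinearFunctions.

Section Cocycles.
Variables (Q : quiver) (k : fieldType) (I : path_algebra Q k -> Prop).
Hypothesis I2 : exists2 P : qpath Q -> Prop,
    (forall p, P p -> size (parrows p) = 2%N) &
    (forall f, I f <-> ideal_generated_by P f).
Variables M N : rep Q k.
Implicit Type d : forall a : arrow Q, 'Hom(M (src a), N (tgt a)).

(** The condition for [ab] to act as zero on the sum of [N] and [M] when each arrow acts by a
    triangular matrix with off-diagonal entry [d]. *)
Definition cocycle d := forall a b (e : tgt a = src b),
  arrows_in I [:: a; b] -> forall u,
  rep_map N b (ecast z (N z) e (d a u)) +
  d b (ecast z (M z) e (rep_map M a u)) = 0.

(** These [d] become zero after the change of splitting $(n, m) \mapsto (n + h m, m)$. *)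
Definition coboundary d := exists h : forall x, 'Hom(M x, N x),
  forall a u, d a u = rep_map N a (h _ u) - h _ (rep_map M a u).

Lemma ecast_nat (V W : vertex Q -> vectType k) (f : forall x, V x -> W x)
    x y (e : x = y) u : f y (ecast z (V z) e u) = ecast z (W z) e (f x u).
Proof. by case: y / e. Qed.

Hypotheses (Mmod : is_module I M) (Nmod : is_module I N).

Section ExtensionCocycle.
Variable X : extension I M N.

Let i := ext_inj X.
Let p := ext_proj X.
Let s x : 'Hom(M x, ext_mid X x) := (p x)^-1%VF.
Let r x : 'Hom(ext_mid X x, N x) := (i x)^-1%VF.

Lemma ext_projK x u : p x (s x u) = u.
Proof. by apply: limg_lfunVK; rewrite ext_proj_img memvf. Qed.

Lemma ext_injK x u : r x (i x u) = u.
Proof. by apply: lker0_lfunK; rewrite ext_inj_ker. Qed.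

Lemma ext_proj_inj x u : p x (i x u) = 0.
Proof.
by apply/eqP; rewrite -memv_ker -ext_exact; apply: memv_img (memvf _).
Qed.

Lemma ext_injVK x v : p x v = 0 -> i x (r x v) = v.
Proof.
by move=> pv; apply: limg_lfunVK; rewrite ext_exact memv_ker; apply/eqP.
Qed.

Lemma ext_comm (A B : rep Q k) (f : rep_hom A B) a u :
  rep_map B a (f _ u) = f _ (rep_map A a u).
Proof. by rewrite -!comp_lfunE hom_comm. Qed.

(** The linear section [s] of the projection need not be a morphism; its defect at [a] lies in the
    image of [N], and [r] pulls it back. *)
Definition ext_cocycle a : 'Hom(M (src a), N (tgt a)) :=
  (r _ \o ((rep_map (ext_mid X) a \o s _) - (s _ \o rep_map M a)))%VF.

Lemma ext_cocycleE a u :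
  i _ (ext_cocycle a u) = rep_map (ext_mid X) a (s _ u) - s _ (rep_map M a u).
Proof.
rewrite comp_lfunE add_lfunE opp_lfunE !comp_lfunE ext_injVK //.
by rewrite linearB /= -ext_comm !ext_projK subrr.
Qed.

Lemma ext_cocycleP : cocycle ext_cocycle.
Proof.
move=> a b e ab u.
have zero (A : rep Q k) : is_module I A -> forall v,
    rep_map A b (ecast z (A z) e (rep_map A a v)) = 0.
  by move=> /(is_moduleP I2) /(_ a b e ab).
(* After the injection the two defects telescope. What remains is the action of [ab] on the middle
   term and on [M], and both are zero. *)
apply: (can_inj (@ext_injK _)); rewrite linear0 linearD /= ext_cocycleE.
rewrite -ext_comm zero // linear0 subr0.
rewrite (ecast_nat (fun x => i x)) ext_cocycleE.
rewrite (ecast_nat (fun x => s x)) -linearD /= -[X in X + _]scale1r.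
by rewrite -ecast_linear scale1r subrK zero //; apply: ext_mid_module.
Qed.

End ExtensionCocycle.

Lemma ext_equivP (X Y : extension I M N) :
  coboundary (fun a => ext_cocycle X a - ext_cocycle Y a) -> ext_equiv X Y.
Proof.
move=> [h hP].
pose iX := ext_inj X; pose pX := ext_proj X.
pose iY := ext_inj Y; pose pY := ext_proj Y.
pose sX x := (pX x)^-1%VF; pose rX x := (iX x)^-1%VF; pose sY x := (pY x)^-1%VF.
(* [phi] sends $i_X n + s_X m$ to $i_Y (n + h m) + s_Y m$. *)
pose phi x : 'Hom(ext_mid X x, ext_mid Y x) :=
  ((iY x \o ((rX x \o (\1 - (sX x \o pX x))) + (h x \o pX x))) +
   (sY x \o pX x))%VF.
have phiE x v : phi x v =
    iY x (rX x (v - sX x (pX x v)) + h x (pX x v)) + sY x (pX x v).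
  by rewrite !(add_lfunE, comp_lfunE, opp_lfunE, id_lfunE).
have phi_i x u : phi x (iX x u) = iY x u.
  by rewrite phiE ext_proj_inj !linear0 !addr0 ext_injK.
have phi_s x u : phi x (sX x u) = iY x (h x u) + sY x u.
  by rewrite phiE ext_projK subrr linear0 add0r.
have dec x v : v = iX x (rX x (v - sX x (pX x v))) + sX x (pX x v).
  by rewrite ext_injVK ?subrK // linearB /= ext_projK subrr.
have comm a :
    (rep_map (ext_mid Y) a \o phi (src a) =
     phi (tgt a) \o rep_map (ext_mid X) a)%VF.
  suff comm_dec n m : rep_map (ext_mid Y) a (phi _ (iX _ n + sX _ m)) =
      phi _ (rep_map (ext_mid X) a (iX _ n + sX _ m)).
    by apply/lfunP => v; rewrite !comp_lfunE [v]dec.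
  rewrite !linearD /= phi_i ext_comm ext_comm phi_i; congr (_ + _).
  have -> : rep_map (ext_mid X) a (sX _ m) =
      iX _ (ext_cocycle X a m) + sX _ (rep_map M a m).
    by rewrite ext_cocycleE subrK.
  rewrite phi_s !linearD /= phi_i phi_s ext_comm.
  have -> : rep_map (ext_mid Y) a (sY _ m) =
      iY _ (ext_cocycle Y a m) + sY _ (rep_map M a m).
    by rewrite ext_cocycleE subrK.
  rewrite !addrA; congr (_ + _); rewrite -!linearD /=; congr (iY _ _).
  have /eqP := hP a m; rewrite add_lfunE opp_lfunE subr_eq => /eqP ->.
  by rewrite addrAC subrK.
exists (RepHom comm) => x; split; apply/lfunP => v; rewrite comp_lfunE /=.
  exact: phi_i.
by rewrite phiE linearD /= ext_proj_inj add0r ext_projK.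
Qed.

(** * The extension defined by a cocycle *)

Section CocycleExtension.
Variable d : forall a : arrow Q, 'Hom(M (src a), N (tgt a)).
Hypothesis dP : cocycle d.

Definition cone_space (x : vertex Q) : vectType k := (N x * M x)%type.

Definition cone_fun a (v : cone_space (src a)) : cone_space (tgt a) :=
  (rep_map N a v.1 + d a v.2, rep_map M a v.2).

Lemma cone_fun_linear a : linear (@cone_fun a).
Proof.
move=> c u v; rewrite /cone_fun /= !linearP /=.
congr (_, _).
rewrite -[RHS]/(c *: (rep_map N a u.1 + d a u.2) + (rep_map N a v.1 + d a v.2)).
by rewrite scalerDr addrACA.
Qed.

Definition cone := @Rep Q k cone_space (fun a => lfun_of (@cone_fun_linear a)).

Lemma cone_mapE a v :
  rep_map cone a v = (rep_map N a v.1 + d a v.2, rep_map M a v.2).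
Proof. exact: lfun_ofE. Qed.

Lemma ecast_cone x y (e : x = y) (v : cone_space x) :
  ecast z (cone_space z) e v = (ecast z (N z) e v.1, ecast z (M z) e v.2).
Proof. by case: y / e; case: v. Qed.

Lemma cone_module : is_module I cone.
Proof.
apply/(is_moduleP I2) => a b e ab u.
rewrite cone_mapE ecast_cone cone_mapE /=.
have /(is_moduleP I2)/(_ a b e ab)-> := Mmod.
rewrite -[rep_map N a _]scale1r ecast_linear linearP /=.
have /(is_moduleP I2)/(_ a b e ab)-> := Nmod.
by rewrite scaler0 add0r dP.
Qed.

Lemma cone_inj_linear x : linear (fun u : N x => (u, 0) : cone x).
Proof. by move=> c u v; congr (_, _); rewrite /= scaler0 addr0. Qed.

Lemma cone_proj_linear x : linear (fun v : cone x => v.2 : M x).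
Proof. by []. Qed.

Lemma cone_inj_comm a :
  (rep_map cone a \o lfun_of (@cone_inj_linear (src a)) =
   lfun_of (@cone_inj_linear (tgt a)) \o rep_map N a)%VF.
Proof.
by apply/lfunP => u; rewrite !comp_lfunE cone_mapE !lfun_ofE /= !linear0 addr0.
Qed.

Lemma cone_proj_comm a :
  (rep_map M a \o lfun_of (@cone_proj_linear (src a)) =
   lfun_of (@cone_proj_linear (tgt a)) \o rep_map cone a)%VF.
Proof.
by apply/lfunP => u; rewrite !comp_lfunE cone_mapE !lfun_ofE.
Qed.

Definition cone_inj : rep_hom N cone :=
  @RepHom _ _ N cone (fun x => lfun_of (@cone_inj_linear x)) cone_inj_comm.
Definition cone_proj : rep_hom cone M :=
  @RepHom _ _ cone M (fun x => lfun_of (@cone_proj_linear x)) cone_proj_comm.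

Lemma cone_inj_ker x : lker (cone_inj x) = 0%VS.
Proof. by apply/eqP/lker0P => u v; rewrite !lfun_ofE => -[]. Qed.

Lemma cone_exact x : limg (cone_inj x) = lker (cone_proj x).
Proof.
apply/vspaceP => v; rewrite memv_ker lfun_ofE.
apply/memv_imgP/eqP => [[u _ ->]|v0]; first by rewrite lfun_ofE.
by exists v.1; rewrite ?memvf // lfun_ofE -v0; case: (v).
Qed.

Lemma cone_proj_img x : limg (cone_proj x) = fullv.
Proof.
apply/vspaceP => v; rewrite memvf; apply/memv_imgP.
by exists (0, v); rewrite ?memvf // lfun_ofE.
Qed.

Definition cone_extension : extension I M N :=
  Extension cone_module cone_inj_ker cone_exact cone_proj_img.

End CocycleExtension.

Lemma zero_cocycle : cocycle (fun=> 0).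
Proof.
move=> a b e _ u; rewrite !lfunE addr0 (_ : ecast z (N z) e 0 = 0) ?linear0 //.
by case: _ / e.
Qed.

(** An equivalence with the split extension fixes [N] and induces the identity on [M], so it is $(n,
    m) \mapsto (n + h m, m)$. Its compatibility with the arrows is the coboundary equation for
    [h]. *)
Lemma coboundary_of_equiv d (dP : cocycle d) :
  ext_equiv (cone_extension dP) (cone_extension zero_cocycle) -> coboundary d.
Proof.
move=> [phi phiP].
have phi_inj x u : phi x (u, 0) = (u, 0) :> cone_space x.
  have [/lfunP/(_ u)] := phiP x.
  by rewrite comp_lfunE /= !lfun_ofE.
have phi_proj x v : (phi x v).2 = v.2.
  by have [_ /lfunP/(_ v)] := phiP x; rewrite comp_lfunE /= !lfun_ofE.
have h_linear x : linear (fun u : M x => (phi x (0, u)).1 : N x).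
  move=> c u v; rewrite -[RHS]/((c *: phi x (0, u) + phi x (0, v)).1).
  by rewrite -linearP; congr (phi x _).1; congr (_, _); rewrite /= scaler0 addr0.
exists (fun x => lfun_of (@h_linear x)) => a u; rewrite !lfun_ofE.
have /lfunP/(_ (0, u)) := hom_comm phi a.
rewrite !comp_lfunE !cone_mapE /= linear0 add0r lfunE addr0 phi_proj.
have -> : (d a u, rep_map M a u) =
    ((d a u, 0) : cone_space _) + (0, rep_map M a u).
  by congr (_, _); rewrite /= ?addr0 ?add0r.
rewrite linearD /= phi_inj => /(congr1 (fun v => v.1)) /= ->.
by rewrite addrK.
Qed.

(** A cocycle is compared with the zero cocycle through their cones; conversely, the cocycles of two
    extensions differ by a cocycle. *)
Lemma Ext1_zeroP : Ext1_zero I M N <-> forall d, cocycle d -> coboundary d.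
Proof.
split=> [ext0 d dP|H X Y]; first exact: (coboundary_of_equiv (ext0 _ _)).
apply: ext_equivP; apply: H => a b e ab u.
have := ext_cocycleP X e ab u; have := ext_cocycleP Y e ab u.
rewrite !add_lfunE !opp_lfunE => Y0 X0.
rewrite [ext_cocycle X a u - _]addrC -scaleN1r ecast_linear linearP /= scaleN1r.
by rewrite [- _ + _]addrC addrACA X0 add0r -opprD Y0 oppr0.
Qed.

End Cocycles.

(** * Cocycles of string modules as matrices *)

Section GradedMatrices.
Variables (Q : quiver) (k : fieldType) (w : word Q).
Local Notation n := (wlen w).+1.
Local Notation v := (@wvertex Q w).
Local Notation sp := (smod_space k w).
Implicit Types (x y : vertex Q) (A B : 'M[k]_n).

(** A block of a square matrix over all positions. The matrix does not depend on the vertices, so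
    transports along equalities of vertices disappear ([ecast_mxhom]). Vectors are rows, so products
    read left to right, as paths do. *)
Definition mxhom_fun x y A (f : sp x) : sp y :=
  [ffun j : smod_basis w y => \sum_i f i * A (val i) (val j)].

Lemma mxhom_linear x y A : linear (@mxhom_fun x y A).
Proof.
move=> c f g; apply/ffunP => j; rewrite !ffunE scaler_sumr -big_split /=.
by apply: eq_bigr => i _; rewrite !ffunE mulrDl -scalerAl.
Qed.

Definition mxhom x y A : 'Hom(sp x, sp y) := lfun_of (@mxhom_linear x y A).

Lemma mxhomE x y A f j : mxhom x y A f j = \sum_i f i * A (val i) (val j).
Proof. by rewrite lfun_ofE ffunE. Qed.

Lemma ecast_mxhom x y y' (e : y = y') A f :
  ecast z (sp z) e (mxhom x y A f) = mxhom x y' A f.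
Proof. by case: y' / e. Qed.

Definition mxsupp x y A := forall i j, A i j != 0 -> v i = x /\ v j = y.
Definition mxgraded A := forall i j, A i j != 0 -> v i = v j.

Lemma mxhomD x y A B f : mxhom x y (A + B) f = mxhom x y A f + mxhom x y B f.
Proof.
apply/ffunP => j; rewrite ffunE !mxhomE -big_split.
by apply: eq_bigr => i _; rewrite mxE mulrDr.
Qed.

Lemma mxhomN x y A f : mxhom x y (- A) f = - mxhom x y A f.
Proof.
apply/ffunP => j; rewrite ffunE !mxhomE -sumrN.
by apply: eq_bigr => i _; rewrite mxE mulrN.
Qed.


Lemma sum_smod_basis x (F : 'I_n -> k) :
  (forall i, v i != x -> F i = 0) ->
  \sum_(i : smod_basis w x) F (val i) = \sum_i F i.
Proof.
move=> F0; rewrite [RHS](bigID (fun i => v i == x)) /= [X in _ + X]big1 ?addr0 //.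
by rewrite (big_sub (fun i => v i == x)).
Qed.

(** The intermediate sum over the positions at [y] extends to all positions, since [A] vanishes
    elsewhere on the rows at [x]. *)
Lemma mxhomM_gen x y y' A B f :
  (forall i j, v i = x -> A i j != 0 -> v j = y) ->
  mxhom y y' B (mxhom x y A f) = mxhom x y' (A *m B) f.
Proof.
move=> sA; apply/ffunP => j; rewrite !mxhomE.
under eq_bigr => l _ do rewrite mxhomE mulr_suml.
rewrite exchange_big; apply: eq_bigr => i _; rewrite mxE mulr_sumr.
rewrite -(@sum_smod_basis y (fun l => f i * (A (val i) l * B l (val j)))).
  by apply: eq_bigr => l _; rewrite mulrA.
move=> l vl; have [->|/(sA _ _ (eqP (valP i))) e] := eqVneq (A (val i) l) 0.
  by rewrite mul0r mulr0.
by rewrite e eqxx in vl.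
Qed.

Lemma mxhomM x y y' A B f : mxsupp x y A ->
  mxhom y y' B (mxhom x y A f) = mxhom x y' (A *m B) f.
Proof. by move=> sA; apply: mxhomM_gen => i j _ /sA[]. Qed.

Lemma mxhomM_diag x y H B f : mxgraded H ->
  mxhom x y B (mxhom x x H f) = mxhom x y (H *m B) f.
Proof. by move=> dH; apply: mxhomM_gen => i j <- /dH. Qed.

Definition smod_delta x (i : smod_basis w x) : sp x :=
  [ffun i' => (i' == i)%:R].

(** Extended by zero outside the block, so that [mxhom] recovers [g] ([hommxK]). *)
Definition hommx x y (g : 'Hom(sp x, sp y)) : 'M[k]_n := \matrix_(i, j)
  if (insub i : option (smod_basis w x), insub j : option (smod_basis w y))
    is (Some i', Some j') then g (smod_delta i') j' else 0.

Lemma hommx_supp x y g : mxsupp x y (@hommx x y g).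
Proof.
move=> i j; rewrite mxE.
case: insubP => [i' /eqP -> _|]; last by rewrite eqxx.
by case: insubP => [j' /eqP -> _|]; last by rewrite eqxx.
Qed.

Lemma hommxE x y g (i : smod_basis w x) (j : smod_basis w y) :
  @hommx x y g (val i) (val j) = g (smod_delta i) j.
Proof. by rewrite mxE !valK. Qed.

Lemma hommxK x y g f : mxhom x y (hommx g) f = g f.
Proof.
have -> : f = \sum_i f i *: smod_delta i.
  apply/ffunP => i; rewrite sum_ffunE (bigD1 i) //= !ffunE eqxx big1 => [|l li].
    by rewrite addr0 [RHS]mulr1.
  by rewrite !ffunE eq_sym (negPf li) [LHS]mulr0.
rewrite !linear_sum; apply: eq_bigr => i _; rewrite !linearZ /=; congr (_ *: _).
apply/ffunP => j; rewrite mxhomE (bigD1 i) //= ffunE eqxx mul1r hommxE.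
by rewrite big1 ?addr0 // => l li; rewrite ffunE (negPf li) mul0r.
Qed.

Lemma mxhom_delta x y A (i : smod_basis w x) (j : smod_basis w y) :
  mxhom x y A (smod_delta i) j = A (val i) (val j).
Proof.
rewrite mxhomE (bigD1 i) //= ffunE eqxx mul1r big1 ?addr0 // => l li.
by rewrite ffunE (negPf li) mul0r.
Qed.

Lemma mxhom_inj x y A B : mxsupp x y A -> mxsupp x y B ->
  (forall f, mxhom x y A f = mxhom x y B f) -> A = B.
Proof.
move=> sA sB AB; apply/matrixP => i j.
have [/andP[vi vj]|nv] := boolP ((v i == x) && (v j == y)).
  by have := mxhom_delta A (Sub i vi) (Sub j vj); rewrite AB mxhom_delta !SubK.
have zero (C : 'M[k]_n) : mxsupp x y C -> C i j = 0.
  by move=> sC; have [//|/sC[e e']] := eqVneq (C i j) 0; rewrite e e' !eqxx in nv.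
by rewrite !zero.
Qed.

Lemma mulmx_neq0 A B i j :
  (A *m B) i j != 0 -> exists2 l, A i l != 0 & B l j != 0.
Proof.
move=> AB; have /existsP[l /andP[]] : [exists l, (A i l != 0) && (B l j != 0)].
  apply: contraNT AB => /existsPn h; rewrite mxE big1 // => l _.
  by apply/eqP; rewrite mulf_eq0 -[_ || _]negbK negb_or h.
by exists l.
Qed.

Lemma mxsuppM x y y' A B :
  mxsupp x y A -> mxsupp y y' B -> mxsupp x y' (A *m B).
Proof. by move=> sA sB i j /mulmx_neq0[l /sA[-> _] /sB[_ ->]]. Qed.

Lemma mxsuppMl x y H A : mxgraded H -> mxsupp x y A -> mxsupp x y (H *m A).
Proof. by move=> dH sA i j /mulmx_neq0[l /dH-> /sA[]]. Qed.

Lemma mxsuppMr x y H A : mxgraded H -> mxsupp x y A -> mxsupp x y (A *m H).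
Proof. by move=> dH sA i j /mulmx_neq0[l /sA[-> <-] /dH->]. Qed.

Lemma mxsuppD x y A B : mxsupp x y A -> mxsupp x y B -> mxsupp x y (A + B).
Proof.
move=> sA sB i j; rewrite mxE; have [->|/sA //] := eqVneq (A i j) 0.
by rewrite add0r => /sB.
Qed.

Lemma mxsuppN x y A : mxsupp x y A -> mxsupp x y (- A).
Proof. by move=> sA i j; rewrite mxE oppr_eq0 => /sA. Qed.

Lemma mxsupp0 x y : mxsupp x y 0.
Proof. by move=> i j; rewrite mxE eqxx. Qed.

Lemma mxhom0 x y f : mxhom x y 0 f = 0.
Proof. by apply/ffunP => j; rewrite mxhomE ffunE big1 // => i _; rewrite mxE mulr0. Qed.

Definition sends_mx a : 'M[k]_n := \matrix_(i, j) (@sends Q w a i j)%:R.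
Local Notation S := sends_mx.
Local Notation sm := (string_module k w).

Lemma string_module_map a f : rep_map sm a f = mxhom _ _ (S a) f.
Proof.
apply/ffunP => j; rewrite lfunE ffunE mxhomE big_mkcond.
by apply: eq_bigr => i _; rewrite mxE; case: sends; rewrite ?mulr1 ?mulr0.
Qed.

Hypothesis sends_supp : forall a, mxsupp (src a) (tgt a) (S a).

Variable I : path_algebra Q k -> Prop.

Definition mxcocycle (D : arrow Q -> 'M[k]_n) :=
  (forall a, mxsupp (src a) (tgt a) (D a)) /\
  forall a b, tgt a = src b -> arrows_in I [:: a; b] ->
    S a *m D b + D a *m S b = 0.

Definition mxcoboundary (D : arrow Q -> 'M[k]_n) :=
  exists2 H, mxgraded H & forall a, D a = H *m S a - S a *m H.

Lemma cocycle_mxP :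
  (forall d, @cocycle Q k I sm sm d -> coboundary d) <->
  (forall D, mxcocycle D -> mxcoboundary D).
Proof.
split=> [cobd D [sD DI]|cobD d dI].
  have [|h hP] := cobd (fun a => mxhom _ _ (D a)).
    move=> a b e ab f; rewrite !string_module_map.
    rewrite (ecast_mxhom e) (ecast_mxhom e) !mxhomM -?e // -mxhomD.
    by rewrite addrC DI // mxhom0.
  (* The summands have disjoint supports: [H] is block diagonal with blocks [h x]. *)
  pose H := \sum_x hommx (h x).
  have dH : mxgraded H.
    move=> i j; have [//|ne] := eqVneq (v i) (v j).
    rewrite summxE big1 ?eqxx // => x _; apply/eqP; apply: contraNT ne.
    by move=> /hommx_supp[-> ->].
  have HE x f : mxhom x x H f = h x f.
    rewrite -[RHS]hommxK; apply/ffunP => j; rewrite !mxhomE.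
    apply: eq_bigr => i _; congr (_ * _); rewrite summxE (bigD1 x) //= big1.
      by rewrite addr0.
    move=> y yx; apply/eqP; apply: contraNT yx => /hommx_supp[<- _].
    exact: valP i.
  exists H => // a; apply: (mxhom_inj (sD a)).
    by apply: mxsuppD; [apply: mxsuppMl | apply: mxsuppN; apply: mxsuppMr].
  move=> f; rewrite hP mxhomD mxhomN !string_module_map -!HE.
  by rewrite mxhomM_diag // mxhomM.
have [|H dH HP] := cobD (fun a => hommx (d a)).
  split=> [a|a b e ab]; first exact: hommx_supp.
  have sb : mxsupp (tgt a) (tgt b) (S b) by rewrite e.
  apply: (@mxhom_inj (src a) (tgt b)) => [||f].
  - apply: mxsuppD; last exact: mxsuppM (@hommx_supp _ _ _) sb.
    by apply: (mxsuppM (@sends_supp a)); rewrite e; apply: hommx_supp.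
  - exact: mxsupp0.
  rewrite mxhom0 mxhomD.
  rewrite -(mxhomM (tgt b) (hommx (d b)) f (@sends_supp a)).
  rewrite -(mxhomM (tgt b) (S b) f (@hommx_supp _ _ (d a))).
  have := dI a b e ab f; rewrite !string_module_map -[d a f]hommxK.
  rewrite (ecast_mxhom e) (ecast_mxhom e) -[d b _]hommxK addrC => <-.
  have mid A B : mxhom (tgt a) (tgt b) A (mxhom (src a) (tgt a) B f) =
      mxhom (src b) (tgt b) A (mxhom (src a) (src b) B f).
    by case: (src b) / e.
  by rewrite !mid.
exists (fun x => mxhom x x H) => a f.
rewrite -[LHS]hommxK HP mxhomD mxhomN !string_module_map.
by rewrite mxhomM_diag // mxhomM.
Qed.

Hypothesis I2 : exists2 P : qpath Q -> Prop,
    (forall p, P p -> size (parrows p) = 2%N) &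
    (forall f, I f <-> ideal_generated_by P f).
Hypothesis sends0 : forall a b,
  tgt a = src b -> arrows_in I [:: a; b] -> S a *m S b = 0.

Lemma string_module_module : is_module I sm.
Proof.
apply/(is_moduleP I2) => a b e ab f; rewrite !string_module_map.
by rewrite (ecast_mxhom e) mxhomM -?e // sends0 // mxhom0.
Qed.

Lemma exceptional_mxP : exceptional I sm <->
  forall D, mxcocycle D -> mxcoboundary D.
Proof.
rewrite -cocycle_mxP /exceptional Ext1_zeroP //; last exact: string_module_module.
- by split=> [[]|] //; split=> //; apply: string_module_module.
- exact: string_module_module.
Qed.

End GradedMatrices.

(** * Positions in a string *)

Lemma sorted_onth (T : Type) (r : rel T) s i x y : sorted r s ->
  onth s i = Some x -> onth s i.+1 = Some y -> r x y.
Proof.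
elim: s i => [|z s IH] [|i] //=; last by move=> /path_sorted; apply: IH.
by case: s {IH} => [|z' s] //= /andP[rzz' _] [<-] [<-].
Qed.

Lemma onth_none (T : Type) (s : seq T) i : onth s i = None -> (size s <= i)%N.
Proof. by rewrite -onthNE => ->. Qed.

Section Words.
Variables (Q : quiver) (sigma eps : arrow Q -> bool).
Implicit Types (w : word Q) (l : letter Q).

Definition sg_start l := if l.1 then sigma l.2 else eps l.2.
Definition sg_end l := if l.1 then eps l.2 else sigma l.2.

(** Composability with the sign rule of concatenation. By [is_stringP] this one test also excludes
    relations and a letter followed by its inverse. *)
Definition adj : rel (letter Q) := fun l l' =>
  (lend l == lstart l') && (sg_start l' == ~~ sg_end l).

Lemma linvK : involutive (@linv Q).
Proof. by case=> d a; rewrite /linv /= negbK. Qed.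

Lemma linv_neq l : linv l <> l.
Proof. by case: l => [[] a]. Qed.

Lemma sg_start_linv l : sg_start (linv l) = sg_end l.
Proof. by case: l => [[] a]. Qed.

Lemma sg_end_linv l : sg_end (linv l) = sg_start l.
Proof. by case: l => [[] a]. Qed.

Lemma lstart_linv l : lstart (linv l) = lend l.
Proof. by case: l => [[] a]. Qed.

Lemma lend_linv l : lend (linv l) = lstart l.
Proof. by case: l => [[] a]. Qed.

Lemma adj_linv l l' : adj l l' = adj (linv l') (linv l).
Proof.
rewrite /adj lend_linv lstart_linv sg_start_linv sg_end_linv eq_sym.
by congr (_ && _); case: sg_start; case: sg_end.
Qed.

Lemma letters_winv w : letters (winv w) = map (@linv Q) (rev (letters w)).
Proof. by case: w => // l s; rewrite [in RHS]/letters lastI rev_rcons. Qed.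

Lemma wlen_winv w : wlen (winv w) = wlen w.
Proof. by rewrite /wlen letters_winv size_map size_rev. Qed.

Lemma wsigma_winv w : wsigma sigma eps (winv w) = weps sigma eps w.
Proof. by case: w => [x t|l s] //=; case: last => [[] a]. Qed.

Lemma winvK : involutive (@winv Q).
Proof.
case=> [x t|l s] /=; first by rewrite negbK.
case/lastP: s => [|s m] /=; first by rewrite linvK.
rewrite last_rcons belast_rcons rev_cons map_rcons last_rcons belast_rcons.
rewrite linvK rev_cons map_rcons linvK -map_rev revK -map_comp.
by rewrite map_id_in // => x _ /=; rewrite linvK.
Qed.

Lemma weps_winv w : weps sigma eps (winv w) = wsigma sigma eps w.
Proof. by rewrite -{2}[w]winvK wsigma_winv. Qed.

Lemma wstart_winv w : wstart (winv w) = wend w.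
Proof. by case: w => [x t|l s] //=; apply: lstart_linv. Qed.

Lemma wend_winv w : wend (winv w) = wstart w.
Proof. by rewrite -{2}[w]winvK wstart_winv. Qed.

Lemma sorted_adj_linv s :
  sorted adj (map (@linv Q) (rev s)) = sorted adj s.
Proof.
rewrite sorted_map rev_sorted; apply: eq_sorted => l l' /=.
by rewrite [RHS]adj_linv.
Qed.

Section Positions.
Variable w : word Q.
Local Notation n := (wlen w).
Local Notation lt := (onth (letters w)).

Definition vtx i := nth (wstart w) (wstart w :: map (@lend Q) (letters w)) i.

(* The sign of the right-hand side of position i; the left-hand side has the *)
(* opposite sign.                                                            *)
Definition rsign i := if lt i is Some l then sg_start l else ~~ weps sigma eps w.

Hypothesis sorted_w : sorted adj (letters w).

Lemma onth_lt i l : lt i = Some l -> (i < n)%N.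
Proof. by move=> il; rewrite /wlen -onthTE il. Qed.

Lemma rsign0 : rsign 0 = wsigma sigma eps w.
Proof. by rewrite /rsign; case: (w) => //= x t; rewrite negbK. Qed.

Lemma rsign_end : rsign n = ~~ weps sigma eps w.
Proof. by rewrite /rsign onth_default. Qed.

Lemma last_onth l0 : (0 < n)%N -> lt n.-1 = Some (last l0 (letters w)).
Proof.
rewrite /wlen -nth_last => n0; case e: (lt _) => [l|].
  by rewrite (onth_nth l0 _ _ _ e).
by have := onth_none e; rewrite leqNgt prednK ?leqnn.
Qed.

Lemma rsignS i l : lt i = Some l -> rsign i.+1 = ~~ sg_end l.
Proof.
move=> il; rewrite /rsign; case e: (lt i.+1) => [l'|].
  by have /andP[_ /eqP] := sorted_onth sorted_w il e.
have il' := onth_lt il; have ni : i = n.-1.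
  by move: (onth_none e) il'; rewrite /wlen; lia.
have := last_onth l (leq_ltn_trans (leq0n i) il'); rewrite -ni il.
case: (w) il => [x t|l1 s] /=; first by rewrite onth0n.
by move=> _ [->].
Qed.

Lemma vtx0 : vtx 0 = wstart w. Proof. by []. Qed.

Lemma vtxS i l : lt i = Some l -> vtx i.+1 = lend l.
Proof.
move=> il; rewrite /vtx /= (nth_map l) ?(onth_nth l _ _ _ il) //; exact: onth_lt il.
Qed.

Lemma vtxE i l : lt i = Some l -> vtx i = lstart l.
Proof.
case: i => [|i] il; first by rewrite vtx0; case: (w) il => //= l1 s [->].
case e: (lt i) => [l'|]; last first.
  by move: (onth_none e) (onth_lt il); rewrite /wlen; lia.
by rewrite (vtxS e); have /andP[/eqP] := sorted_onth sorted_w e il.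
Qed.

Lemma vtx_end : vtx n = wend w.
Proof.
rewrite /vtx /wlen; case: (w) => [x t|l s] //=.
rewrite -[_ :: _]/(map (@lend Q) (l :: s)) (nth_map l) //.
by rewrite -[size s]/(size (l :: s)).-1 nth_last.
Qed.

Local Notation snd := (@sends Q w).
Implicit Types i j : 'I_n.+1.

Lemma sendsP a i j : reflect
  ((j = i.+1 :> nat /\ lt i = Some (true, a)) \/
   (i = j.+1 :> nat /\ lt j = Some (false, a))) (snd a i j).
Proof.
apply: (iffP orP) => -[].
- by move=> /andP[/eqP ? /eqP ?]; left.
- by move=> /andP[/eqP ? /eqP ?]; right.
- by move=> [-> ->]; left; rewrite !eqxx.
- by move=> [-> ->]; right; rewrite !eqxx.
Qed.

Lemma sends_vtx a i j : snd a i j -> vtx i = src a /\ vtx j = tgt a.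
Proof.
by move=> /sendsP[] [-> e]; rewrite (vtxE e) (vtxS e).
Qed.

(** [sigma a] is the sign of the side on which [a] leaves [i], and [eps a] that of the side on which
    it enters [j], in whichever direction the letter is read. *)
Lemma sends_sign a i j : snd a i j ->
  [/\ j = i.+1 :> nat, lt i = Some (true, a), sigma a = rsign i &
      eps a = ~~ rsign j] \/
  [/\ i = j.+1 :> nat, lt j = Some (false, a), sigma a = ~~ rsign i &
      eps a = rsign j].
Proof.
move=> /sendsP[] [ij e]; [left|right]; rewrite ij (rsignS e) {1}/rsign e /sg_start /=;
  by rewrite ?negbK.
Qed.

Lemma sends_out_uniq a a' i j j' : snd a i j -> snd a' i j' ->
  sigma a = sigma a' -> a = a' /\ j = j'.
Proof.
move=> /sends_sign[] [e l s _] /sends_sign[] [e' l' s' _];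
  rewrite s s' => //= ss.
- by move: l'; rewrite l => -[->]; split=> //; apply: val_inj; rewrite /= e e'.
- by case: rsign ss.
- by case: rsign ss.
- have jj : j = j' by apply: val_inj; move: e'; rewrite e => -[].
  by move: l'; rewrite -jj l => -[->].
Qed.

Lemma sends_in_uniq a a' i i' j : snd a i j -> snd a' i' j ->
  eps a = eps a' -> a = a' /\ i = i'.
Proof.
move=> /sends_sign[] [e l _ s] /sends_sign[] [e' l' _ s']; rewrite s s' => //= ss.
- have ii : i = i' by apply: val_inj; move: e'; rewrite e => -[].
  by move: l'; rewrite -ii l => -[->].
- by case: rsign ss.
- by case: rsign ss.
- by move: l'; rewrite l => -[->]; split=> //; apply: val_inj; rewrite /= e e'.
Qed.

(** The two arrows lie on opposite sides of [i], whereas a relation [ba] would give equal signs.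
    This is why $M(w)$ satisfies the relations. *)
Lemma sends_in_out a b i j j' : snd b j i -> snd a i j' -> eps b <> sigma a.
Proof.
move=> /sends_sign[] [e l _ s] /sends_sign[] [e' l' s' _]; rewrite s s'.
- by case: rsign.
- move=> _; have jj : j = j' by apply: val_inj; move: e'; rewrite e => -[].
  by move: l'; rewrite -jj l.
- by move=> _; move: l'; rewrite l.
- by case: rsign.
Qed.

(** No letter lies on the side [s] of [i]. Both disjuncts matter for length zero, where the only
    position is free on both sides. *)
Definition side_free i s :=
  (i == n :> nat) && (rsign i == s) || (i == 0 :> nat) && (rsign i == ~~ s).

Variant side_spec i s : Prop :=
| SideFree of side_free i s
| SideOut a j of snd a i j & sigma a = s
| SideIn a j of snd a j i & eps a = s.

Lemma sideP i s : side_spec i s.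
Proof.
have [rs|rs] := eqVneq (rsign i) s.
  have [e|ne] := eqVneq (i : nat) n.
    by apply: SideFree; rewrite /side_free rs e !eqxx.
  have lin : (i < n)%N by move: (ltn_ord i); lia.
  case e : (lt i) => [[d a]|]; last first.
    by move: (onth_none e) lin; rewrite /wlen; lia.
  have iS : (i.+1 < n.+1)%N by lia.
  case: d e => e; [apply: (@SideOut _ _ a (Ordinal iS)) |
    apply: (@SideIn _ _ a (Ordinal iS))].
  - by apply/sendsP; left.
  - by rewrite -rs /rsign e.
  - by apply/sendsP; right.
  - by rewrite -rs /rsign e.
have {}rs : rsign i = ~~ s by case: rsign s rs => [] [].
have [e|ne] := eqVneq (i : nat) 0.
  by apply: SideFree; rewrite /side_free rs e !eqxx orbT.
have iP : (i.-1 < n.+1)%N by move: (ltn_ord i); lia.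
case e : (lt i.-1) => [[d a]|]; last first.
  by move: (onth_none e) (ltn_ord i) ne; rewrite /wlen; lia.
have := rsignS e; rewrite prednK ?lt0n // rs => /negb_inj ->.
case: d e => e; [apply: (@SideIn _ _ a (Ordinal iP)) |
  apply: (@SideOut _ _ a (Ordinal iP))] => //.
- by apply/sendsP; left; rewrite /= prednK // lt0n.
- by apply/sendsP; right; rewrite /= prednK // lt0n.
Qed.

Lemma side_free_out i s a j : side_free i s -> snd a i j -> sigma a <> s.
Proof.
move=> f /sends_sign[] [e l sa _]; rewrite sa; case/orP: f => /andP[/eqP ei /eqP ->].
- by move: (onth_lt l); rewrite ei ltnn.
- by case: s.
- by case: s.
- by rewrite e in ei.
Qed.

Lemma side_free_in i s a j : side_free i s -> snd a j i -> eps a <> s.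
Proof.
move=> f /sends_sign[] [e l _ sa]; rewrite sa; case/orP: f => /andP[/eqP ei /eqP ->].
- by case: s.
- by rewrite e in ei.
- by move: (onth_lt l); rewrite ei ltnn.
- by case: s.
Qed.

End Positions.

Variables (k : fieldType) (I : path_algebra Q k -> Prop).
Hypothesis I2 : exists2 P : qpath Q -> Prop,
    (forall p, P p -> size (parrows p) = 2%N) &
    (forall f, I f <-> ideal_generated_by P f).
Hypothesis signs : sign_functions I sigma eps.

(** For two consecutive arrows opposite signs mean that they form no relation; for letters of
    opposite direction they mean distinct arrows. A longer path in [I] contains a relation of length
    two by [arrows_in_subpath2]. *)
Lemma is_stringP w : is_string I w <-> sorted adj (letters w).
Proof.
split=> [[]|sw].
  elim: (letters w) => //= l [|l' s] IH //= /andP[/andP[e ne] ps] nI.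
  apply/andP; split; last first.
    by apply: IH => // u v u' es; apply: (nI (l :: u)); rewrite es.
  have nI2 := nI [::] [:: l; l'] s erefl; rewrite /adj e /=.
  case: l l' e ne nI2 {IH ps nI} => [[] a] [[] b] /= /eqP e ne nI2;
    rewrite /sg_start /sg_end /=.
  - by rewrite (sign_nonrel signs e) // => /nI2[].
  - by rewrite (sign_tgt signs _ (esym e)) //; apply: contraNneq ne => ->.
  - by rewrite (sign_src signs _ (esym e)) //; apply: contraNneq ne => ->.
  - by rewrite (sign_nonrel signs (esym e)) ?negbK // => /nI2[].
split.
  apply: sub_sorted sw => l l' /andP[-> /= /eqP e].
  by apply/eqP => e'; move: e; rewrite e' sg_start_linv; case: sg_end.
move=> u v u' e s /(arrows_in_subpath2 I2)[a [b [ab inf]]].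
have rel (l l' : letter Q) : l = (true, a) -> l' = (true, b) -> ~ adj l l'.
  move=> -> -> /andP[/eqP /= ab' /eqP /=]; rewrite /sg_start /sg_end /=.
  by rewrite (sign_rel signs ab' ab); case: eps.
have sv : sorted adj v by apply: infix_sorted sw; apply/infixP; exists u, u'.
have sI v' : sorted adj v' -> v' <> map (pair true) s.
  move=> sv' ev'; case/infixP: inf => s1 [s2 es].
  move: sv'; rewrite ev' es map_cat /=.
  by move=> /cat_sorted2[_] /= /andP[h _]; apply: rel h.
by split; apply: sI; rewrite ?sorted_adj_linv.
Qed.

End Words.

(** * The graph of pairs of positions *)

Section Chains.
Variables (V : zmodType) (P : finType).

Lemma chain_source (e : rel P) (r : P -> nat) (c : P -> P -> V) (l : P -> V) :
  (forall p p' q, e p q -> e p' q -> p = p') ->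
  (forall p q, e p q -> r q = (r p).+1) ->
  exists h : P -> V, (forall p q, e p q -> h q = h p + c p q) /\
    (forall q, (forall p, ~~ e p q) -> h q = l q).
Proof.
(* Recursion on the rank: started at [r q], the counter [m] stays equal to the rank of the current
   vertex, so it reaches zero only at a source. *)
move=> e_inj er; pose fix f m q {struct m} := if m is m'.+1 then
  if [pick p | e p q] is Some p then f m' p + c p q else l q else l q.
exists (fun q => f (r q) q); split=> [p q pq|q nq].
  rewrite (er _ _ pq) /=; case: pickP => [p' p'q|/(_ p)]; last by rewrite pq.
  by rewrite (e_inj _ _ _ pq p'q).
by case: (r q) => //= m; case: pickP => // p; rewrite (negPf (nq p)).
Qed.

Variables (e : rel P) (r : P -> nat) (c : P -> P -> V).
Hypothesis e_fun : forall p q q', e p q -> e p q' -> q = q'.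
Hypothesis e_inj : forall p p' q, e p q -> e p' q -> p = p'.
Hypothesis er : forall p q, e p q -> r q = (r p).+1.
Variables (lh rh : pred P) (l d : P -> V).
Hypothesis lhP : forall p q, lh q -> ~~ e p q.
Hypothesis rhP : forall p q, rh p -> ~~ e p q.
Hypothesis lrh : forall p q, lh p -> connect e p q -> ~~ rh q.

(* In each component, a path, the values are propagated from the right end if *)
(* a value is prescribed there, and from the left end otherwise.              *)
Lemma chain_solve : exists h : P -> V,
  [/\ forall p q, e p q -> h q - h p = c p q,
      forall p, lh p -> h p = l p & forall p, rh p -> h p = d p].
Proof.
have [hl [hlE hl0]] := chain_source c l e_inj er.
have rmax p : (r p <= \max_q r q)%N by apply: leq_bigmax.
have er' p q : e q p -> (\max_q r q - r q)%N = (\max_q r q - r p).+1.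
  by move=> qp; have := rmax p; rewrite (er qp); lia.
(* The same construction on the reversed relation, ranked by the distance below the largest rank. *)
have [hr [hrE hr0]] := @chain_source (fun p q => e q p)
  (fun p => \max_q r q - r p)%N (fun p q => - c q p) d
  (fun p p' q qp qp' => e_fun qp qp') er'.
pose right p := [exists q, connect e p q && rh q].
exists (fun p => if right p then hr p else hl p); split=> [p q pq|p lp|p rp].
- have -> : right p = right q.
    apply/existsP/existsP => -[x /andP[px rx]]; exists x; rewrite rx andbT; last first.
      exact: connect_trans (connect1 pq) px.
    case/connectP: px rx => [[|y s] /= ps ->]; first by move=> /(@rhP _ q); rewrite pq.
    case/andP: ps => py ys _; rewrite (e_fun pq py); apply/connectP.
    by exists s.
  case: ifP => _; last by rewrite (hlE _ _ pq) addrAC subrr add0r.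
  by rewrite (hrE _ _ pq) opprD opprK addrA subrr add0r.
- case: ifP => [/existsP[q /andP[pq rq]]|_]; first by have := lrh lp pq; rewrite rq.
  by apply: hl0 => q; apply: lhP.
- case: ifP => [_|/existsP[]]; first by apply: hr0 => q; apply: rhP.
  by exists p; rewrite connect0.
Qed.

End Chains.

(** * Edges and half-edges of the pair graph *)

Section PairGraph.
Variables (Q : quiver) (sigma eps : arrow Q -> bool) (w : word Q).
Hypothesis sorted_w : sorted (adj sigma eps) (letters w).
Local Notation n := (wlen w).
Local Notation vt := (vtx w).
Local Notation snd := (@sends Q w).
Local Notation rsgn := (rsign sigma eps w).
Implicit Types (i j : 'I_n.+1) (p q : 'I_n.+1 * 'I_n.+1).

Lemma sends_arrow_uniq a a' i j : snd a i j -> snd a' i j -> a = a'.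
Proof.
move=> /sendsP[] [e l] /sendsP[] [e' l'].
- by move: l'; rewrite l => -[].
- by move: e; rewrite e'; lia.
- by move: e; rewrite e'; lia.
- by move: l'; rewrite l => -[].
Qed.

Lemma sends_asym a a' i j : snd a i j -> ~~ snd a' j i.
Proof.
move=> /sendsP[] [e l]; apply/negP => /sendsP[] [e' l'].
- by move: e; rewrite e'; lia.
- by move: l'; rewrite l.
- by move: l'; rewrite l.
- by move: e; rewrite e'; lia.
Qed.

(** Edges are oriented so that the second position moves right. The first then moves right or left,
    according to whether [w] is matched with itself or with its inverse. *)
Definition pair_edge p q := (q.2 == p.2.+1 :> nat) &&
  [exists a, snd a p.1 q.1 && snd a p.2 q.2 || snd a q.1 p.1 && snd a q.2 p.2].

Lemma pair_edgeP p q : reflect (q.2 = p.2.+1 :> nat /\ exists a,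
    snd a p.1 q.1 /\ snd a p.2 q.2 \/ snd a q.1 p.1 /\ snd a q.2 p.2)
  (pair_edge p q).
Proof.
apply: (iffP andP) => -[/eqP e].
  by move=> /existsP[a /orP[]/andP[x y]]; split=> //; exists a; [left|right].
by move=> [a xy]; split=> //; apply/existsP; exists a; apply/orP;
  case: xy => -[-> ->]; [left|right].
Qed.

(** The step of the second position to the right fixes the arrow, and a given arrow leaves or enters
    the first position at most once. *)
Lemma pair_edge_fun p q q' : pair_edge p q -> pair_edge p q' -> q = q'.
Proof.
case: p q q' => [i j] [x y] [x' y'] /pair_edgeP[/= e [a h]] /pair_edgeP[/= e' [a' h']].
have yy : y = y' by apply: val_inj; rewrite /= e e'.
subst y'; case: h h' => -[s t] [] [s' t'].
- have aa := sends_arrow_uniq t t'; subst a'.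
  by have [_ ->] := sends_out_uniq sorted_w s s' erefl.
- by have := sends_asym a' t; rewrite t'.
- by have := sends_asym a' t; rewrite t'.
- have aa := sends_arrow_uniq t t'; subst a'.
  by have [_ ->] := sends_in_uniq sorted_w s s' erefl.
Qed.

Lemma pair_edge_inj p p' q : pair_edge p q -> pair_edge p' q -> p = p'.
Proof.
case: p p' q => [x y] [x' y'] [i j] /pair_edgeP[/= e [a h]] /pair_edgeP[/= e' [a' h']].
have yy : y = y' by apply: val_inj => /=; lia.
subst y'; case: h h' => -[s t] [] [s' t'].
- have aa := sends_arrow_uniq t t'; subst a'.
  by have [_ ->] := sends_in_uniq sorted_w s s' erefl.
- by have := sends_asym a' t; rewrite t'.
- by have := sends_asym a' t; rewrite t'.
- have aa := sends_arrow_uniq t t'; subst a'.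
  by have [_ ->] := sends_out_uniq sorted_w s s' erefl.
Qed.

Definition has_out i s := [exists a, [exists j, snd a i j && (sigma a == s)]].
Definition has_in i s := [exists a, [exists j, snd a j i && (eps a == s)]].

Lemma has_outP i s :
  reflect (exists a j, snd a i j /\ sigma a = s) (has_out i s).
Proof.
apply: (iffP existsP) => -[a]; first by move=> /existsP[j /andP[h /eqP e]]; exists a, j.
by move=> [j [h /eqP e]]; exists a; apply/existsP; exists j; apply/andP.
Qed.

Lemma has_inP i s :
  reflect (exists a j, snd a j i /\ eps a = s) (has_in i s).
Proof.
apply: (iffP existsP) => -[a]; first by move=> /existsP[j /andP[h /eqP e]]; exists a, j.
by move=> [j [h /eqP e]]; exists a; apply/existsP; exists j; apply/andP.
Qed.

(* The side s of (i, j) gives a coboundary equation in which H i j is the     *)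
(* only entry of H.                                                          *)
Definition half_edge s p := [&& vt p.1 == vt p.2, ~~ has_out p.1 s,
  ~~ has_in p.2 s & has_out p.2 s || has_in p.1 s].

(** An edge out of [p] uses the letter on the right of [p.2]; it would put a matching arrow on a
    side that the half-edge requires to have none. *)
Lemma half_edge_right p q : half_edge (rsgn p.2) p -> ~~ pair_edge p q.
Proof.
move=> /and4P[_ no ni _]; apply/negP => /pair_edgeP[e [a [] [x y]]].
- case: (sends_sign sorted_w y) => -[e' _ s _]; last by rewrite e' in e; lia.
  by move/has_outP: no; apply; exists a, q.1.
- case: (sends_sign sorted_w y) => -[e' _ _ s]; first by rewrite e' in e; lia.
  by move/has_inP: ni; apply; exists a, q.2.
Qed.

Lemma half_edge_left p q : half_edge (~~ rsgn q.2) q -> ~~ pair_edge p q.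
Proof.
move=> /and4P[_ no ni _]; apply/negP => /pair_edgeP[e [a [] [x y]]].
- case: (sends_sign sorted_w y) => -[e' _ _ s]; last by rewrite e' in e; lia.
  by move/has_inP: ni; apply; exists a, p.2.
- case: (sends_sign sorted_w y) => -[e' _ s _]; first by rewrite e' in e; lia.
  by move/has_outP: no; apply; exists a, p.1.
Qed.

(** * Solving the coboundary equations along the paths *)

Section Matrices.
Variable k : fieldType.
Local Notation S := (@sends_mx Q k w).

Lemma sends_mxl a i l (B : 'M_n.+1) j : snd a i l -> (S a *m B) i j = B l j.
Proof.
move=> il; rewrite mxE (bigD1 l) //= mxE il mul1r big1 ?addr0 // => x xl.
rewrite mxE; case ix: snd; last by rewrite mul0r.
by have [_ e] := sends_out_uniq sorted_w il ix erefl; rewrite e eqxx in xl.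
Qed.

Lemma sends_mxl0 a i (B : 'M_n.+1) j :
  (forall l, ~~ snd a i l) -> (S a *m B) i j = 0.
Proof.
by move=> nil; rewrite mxE big1 // => x _; rewrite mxE (negPf (nil x)) mul0r.
Qed.

Lemma sends_mxr a l j (A : 'M_n.+1) i : snd a l j -> (A *m S a) i j = A i l.
Proof.
move=> lj; rewrite mxE (bigD1 l) //= mxE lj mulr1 big1 ?addr0 // => x xl.
rewrite mxE; case xj: snd; last by rewrite mulr0.
by have [_ e] := sends_in_uniq sorted_w lj xj erefl; rewrite e eqxx in xl.
Qed.

Lemma sends_mxr0 a j (A : 'M_n.+1) i :
  (forall l, ~~ snd a l j) -> (A *m S a) i j = 0.
Proof.
by move=> nil; rewrite mxE big1 // => x _; rewrite mxE (negPf (nil x)) mulr0.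
Qed.

Lemma sends_mx_supp a : mxsupp (src a) (tgt a) (S a).
Proof.
move=> i j; rewrite mxE; case h: (sends a i j); last by rewrite eqxx.
by move=> _; exact: (sends_vtx sorted_w h).
Qed.

Variable I : path_algebra Q k -> Prop.
Hypothesis signs : sign_functions I sigma eps.

Lemma sends_mx0 a b :
  tgt a = src b -> arrows_in I [:: a; b] -> S a *m S b = 0.
Proof.
move=> e ab; apply/matrixP => i j; rewrite [RHS]mxE.
have [/existsP[l il]|/existsPn] := boolP [exists l, snd a i l]; last exact: sends_mxl0.
rewrite (sends_mxl _ _ il) mxE; case lj: snd => //.
by case: (sends_in_out sorted_w il lj); rewrite (sign_rel signs e ab).
Qed.

(** Equal signs only refute that [ab] is outside [I]. That is enough here, since an equality in the
    field [k] may be proved by contradiction. *)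
Lemma mxcocycle_entry (D : arrow Q -> 'M[k]_n.+1) a b i j : mxcocycle I D ->
  tgt a = src b -> sigma b = eps a -> (S a *m D b + D a *m S b) i j = 0.
Proof.
move=> [_ DI] e s; apply/eqP; apply: contraT => ne.
have nab : ~ arrows_in I [:: a; b].
  by move=> ab; move: ne; rewrite DI // mxE eqxx.
by have := sign_nonrel signs e nab; rewrite s; case: eps.
Qed.


Section HalfEdgeValues.
Variable D : arrow Q -> 'M[k]_n.+1.
Implicit Type x : arrow Q * 'I_n.+1.

(** The value of [H] at [p] forced on the side [s], by an arrow out of [p.2] or else by an arrow
    into [p.1]. If both exist, the cocycle condition makes them agree. *)
Definition half_value s p : k :=
  if [pick x | snd x.1 p.2 x.2 && (sigma x.1 == s)] is Some x then D x.1 p.1 x.2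
  else if [pick x | snd x.1 x.2 p.1 && (eps x.1 == s)] is Some x
  then - D x.1 x.2 p.2 else 0.

Lemma half_value_out a i j j' : snd a j j' -> half_value (sigma a) (i, j) = D a i j'.
Proof.
move=> jj; rewrite /half_value; case: pickP => [[b l] /= /andP[jl /eqP e]|].
  by have [-> ->] := sends_out_uniq sorted_w jj jl (esym e).
by move=> /(_ (a, j')) /=; rewrite jj eqxx.
Qed.

Lemma half_value_in a i i' j : snd a i' i -> ~~ has_out j (eps a) ->
  half_value (eps a) (i, j) = - D a i' j.
Proof.
move=> ii no; rewrite /half_value; case: pickP => [[b l] /= /andP[jl /eqP e]|_].
  by case/has_outP: no; exists b, l.
case: pickP => [[b l] /= /andP[li /eqP e]|].
  by have [-> ->] := sends_in_uniq sorted_w ii li (esym e).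
by move=> /(_ (a, i')) /=; rewrite ii eqxx.
Qed.

(** The value imposed on [h q - h p]. For an arrow from [p] to [q], the equation at [(p.1, q.2)]
    prescribes [h p - h q], hence the minus sign. *)
Definition edge_value p q : k :=
  if [pick a | snd a p.1 q.1 && snd a p.2 q.2] is Some a then - D a p.1 q.2
  else if [pick a | snd a q.1 p.1 && snd a q.2 p.2] is Some a
  then D a q.1 p.2 else 0.

Lemma edge_value_out a i i' j j' : snd a i i' -> snd a j j' ->
  edge_value (i, j) (i', j') = - D a i j'.
Proof.
move=> ii jj; rewrite /edge_value; case: pickP => [b /= /andP[ii' _]|/(_ a)] /=.
  by rewrite (sends_arrow_uniq ii ii').
by rewrite ii jj.
Qed.

Lemma edge_value_in a i i' j j' : snd a i' i -> snd a j' j ->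
  edge_value (i, j) (i', j') = D a i' j.
Proof.
move=> ii jj; rewrite /edge_value.
case: pickP => [b /= /andP[ii' _]|_]; first by have := sends_asym b ii; rewrite ii'.
case: pickP => [b /= /andP[ii' _]|/(_ a)] /=.
  by rewrite (sends_arrow_uniq ii ii').
by rewrite ii jj.
Qed.

End HalfEdgeValues.

Lemma has_outN i s a j : ~~ has_out i s -> sigma a = s -> ~~ snd a i j.
Proof. by move=> ni e; apply: contra ni => ij; apply/has_outP; exists a, j. Qed.

Lemma has_inN i s a j : ~~ has_in i s -> eps a = s -> ~~ snd a j i.
Proof. by move=> ni e; apply: contra ni => ij; apply/has_inP; exists a, j. Qed.

Lemma has_out_inN i s : has_out i s -> ~~ has_in i s.
Proof.
move=> /has_outP[a [j [ij e]]]; apply/negP => /has_inP[b [l [li e']]].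
by case: (sends_in_out sorted_w li ij); rewrite e e'.
Qed.

Lemma side_freeP i s : side_free sigma eps i s = ~~ has_out i s && ~~ has_in i s.
Proof.
apply/idP/andP => [f|[no ni]].
  split; apply/negP.
    by move=> /has_outP[a [j [h]]]; apply: (side_free_out sorted_w f h).
  by move=> /has_inP[a [j [h]]]; apply: (side_free_in sorted_w f h).
case: (sideP sorted_w i s) => // a j h e.
  by have := has_outN j no e; rewrite h.
by have := has_inN j ni e; rewrite h.
Qed.

Hypothesis no_isolated : forall a i j, vt i = src a -> vt j = tgt a ->
  side_free sigma eps i (sigma a) -> ~~ side_free sigma eps j (eps a).
Hypothesis no_bad_chain : forall p q, half_edge (~~ rsgn p.2) p ->
  connect pair_edge p q -> ~~ half_edge (rsgn q.2) q.

(** At [(i, j)] the equation for [D a] has a term from [H *m S a] if [a] enters [j], and one from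
    [S a *m H] if [a] leaves [i]. Two terms form an edge and one a half-edge; with none, [D a i j]
    vanishes by a cocycle equation unless the coordinate is isolated. *)
Lemma mxcocycle_coboundary (D : arrow Q -> 'M[k]_n.+1) :
  mxcocycle I D -> mxcoboundary D.
Proof.
move=> DI; have [sD _] := DI.
have [h [hE hL hR]] := @chain_solve _ _ pair_edge (fun p => p.2 : nat) (edge_value D)
  pair_edge_fun pair_edge_inj (fun p q pq => (pair_edgeP p q pq).1)
  (fun p => half_edge (~~ rsgn p.2) p) (fun p => half_edge (rsgn p.2) p)
  (fun p => half_value D (~~ rsgn p.2) p) (fun p => half_value D (rsgn p.2) p)
  half_edge_left half_edge_right no_bad_chain.
have hS s p : half_edge s p -> h p = half_value D s p.
  have [->|ne] := eqVneq s (rsgn p.2); first exact: hR.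
  have -> : s = ~~ rsgn p.2 by case: s (rsgn _) ne => [] [].
  exact: hL.
exists (\matrix_(i, j) if vt i == vt j then h (i, j) else 0).
  by move=> i j; rewrite mxE; case: ifP => [/eqP //|_]; rewrite eqxx.
set H := \matrix_(i, j) _ => a; apply/matrixP => i j.
have dH : mxgraded H.
  by move=> x y; rewrite mxE; case: ifP => [/eqP //|_]; rewrite eqxx.
have HE (x y : 'I_n.+1) : vt x = vt y -> H x y = h (x, y).
  by move=> e; rewrite mxE e eqxx.
have [/andP[/eqP vi /eqP vj]|nv] :=
    boolP ((vt i == src a) && (vt j == tgt a)); last first.
  have zero A : mxsupp (src a) (tgt a) A -> A i j = 0 :> k.
    move=> sA; apply/eqP; apply: contraNT nv => /sA[].
    by rewrite /wvertex /vtx => -> ->; rewrite !eqxx.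
  have sS := @sends_mx_supp a.
  by rewrite !zero //; apply: mxsuppD;
    [apply: mxsuppMl | apply: mxsuppN; apply: mxsuppMr].
have -> : (H *m S a - S a *m H) i j = (H *m S a) i j - (S a *m H) i j.
  by rewrite !mxE.
have [/existsP[l lj]|/existsPn nj] := boolP [exists l, snd a l j].
  have [vl _] := sends_vtx sorted_w lj.
  rewrite (sends_mxr _ _ lj) HE ?vi ?vl //.
  have [/existsP[m im]|/existsPn ni] := boolP [exists m, snd a i m].
    have [_ vm] := sends_vtx sorted_w im.
    rewrite (sends_mxl _ _ im) HE ?vm ?vj //.
    have [[e _ _ _]|[e _ _ _]] := sends_sign sorted_w lj.
      have /hE : pair_edge (i, l) (m, j).
        by apply/pair_edgeP; split=> //; exists a; left.
      by rewrite (edge_value_out D im lj) => hh; rewrite -[RHS]opprB hh opprK.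
    have /hE : pair_edge (m, j) (i, l).
      by apply/pair_edgeP; split=> //; exists a; right.
    by rewrite (edge_value_in D im lj) => ->.
  rewrite sends_mxl0 // subr0.
  have no : ~~ has_out i (sigma a).
    apply/negP => /has_outP[b [m [im e]]].
    have [vi' _] := sends_vtx sorted_w im.
    have ab : a = b.
      apply/eqP; apply: contraT => ne; move: e.
      by rewrite (sign_src signs ne) -?vi' ?vi //; case: sigma.
    by have := ni m; rewrite ab im.
  have ol : has_out l (sigma a) by apply/has_outP; exists a, j.
  rewrite (hS (sigma a)) ?(half_value_out _ _ lj) //.
  by rewrite /half_edge /= vi vl eqxx no ol has_out_inN.
rewrite sends_mxr0 // sub0r.
have nin : ~~ has_in j (eps a).
  apply/negP => /has_inP[b [m [mj e]]].
  have [_ vj'] := sends_vtx sorted_w mj.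
  have ab : a = b.
    apply/eqP; apply: contraT => ne; move: e.
    by rewrite (sign_tgt signs ne) -?vj' ?vj //; case: eps.
  by have := nj m; rewrite ab mj.
have [/existsP[m im]|/existsPn ni] := boolP [exists m, snd a i m].
  have [_ vm] := sends_vtx sorted_w im.
  rewrite (sends_mxl _ _ im) HE ?vm ?vj //.
  have hm : half_edge (eps a) (m, j).
    have om : has_in m (eps a) by apply/has_inP; exists a, i.
    rewrite /half_edge /= vm vj eqxx nin om orbT !andbT /=.
    by apply/negP => om'; have := has_out_inN om'; rewrite om.
  rewrite (hS _ _ hm).
  (* If [b] leaves [j] on this side, [half_value] was taken from [b]; the cocycle condition at
     [(i, j')] shows that [a] prescribes the same value. *)
  have [/has_outP[b [j' [jj' e]]]|no] := boolP (has_out j (eps a)); last first.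
    by rewrite (half_value_in D im) // opprK.
  rewrite -e (half_value_out _ _ jj').
  have [vj' _] := sends_vtx sorted_w jj'.
  have := mxcocycle_entry i j' DI (etrans (esym vj) vj') e.
  rewrite mxE (sends_mxl _ _ im) (sends_mxr _ _ jj') => /eqP.
  by rewrite addrC addr_eq0 => /eqP.
rewrite sends_mxl0 // oppr0.
(* No entry of [H] occurs any more. An arrow out of [j], or one into [i], on the relevant side
   yields a cocycle equation whose only term is [D a i j]. *)
have [/has_outP[b [j' [jj' e]]]|no] := boolP (has_out j (eps a)).
  have [vj' _] := sends_vtx sorted_w jj'.
  have := mxcocycle_entry i j' DI (etrans (esym vj) vj') e.
  by rewrite mxE sends_mxl0 // (sends_mxr _ _ jj') add0r.
have [/has_inP[b [i' [ii' e]]]|ini] := boolP (has_in i (sigma a)).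
  have [_ vi'] := sends_vtx sorted_w ii'.
  have := mxcocycle_entry i' j DI (etrans (esym vi') vi) (esym e).
  by rewrite mxE (sends_mxl _ _ ii') sends_mxr0 // addr0.
have fj : side_free sigma eps j (eps a) by rewrite side_freeP no nin.
have : ~~ side_free sigma eps i (sigma a).
  by apply/negP => fi; have := no_isolated vi vj fi; rewrite fj.
rewrite side_freeP ini andbT negbK => /has_outP[b [m [im e]]].
have [vi' _] := sends_vtx sorted_w im.
have ab : a = b.
  apply/eqP; apply: contraT => ne; move: e.
  by rewrite (sign_src signs ne) -?vi' ?vi //; case: sigma.
by have := ni m; rewrite ab im.
Qed.


(* The coordinate (i, j) of D a occurs in no cocycle equation, and no entry of *)
(* H contributes to it.                                                      *)
Definition isolated a i j := [&& vt i == src a, vt j == tgt a,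
  side_free sigma eps i (sigma a) & side_free sigma eps j (eps a)].

(** The witness is the elementary matrix at [(i, j)] on the arrow [a] alone; the free sides keep it
    out of every cocycle equation. *)
Lemma isolated_not_coboundary a i j : isolated a i j ->
  exists2 D : arrow Q -> 'M[k]_n.+1, mxcocycle I D & ~ mxcoboundary D.
Proof.
case/and4P=> /eqP vi /eqP vj; rewrite !side_freeP => /andP[noi nii] /andP[noj nij].
exists (fun b => if b == a then delta_mx i j else 0).
  split=> [b|b c e bc].
    case: eqP => [->|_]; last exact: mxsupp0.
    move=> x y; rewrite mxE; case: andP => [[/eqP -> /eqP ->] //|_].
    by rewrite eqxx.
  have s := sign_rel signs e bc; apply/matrixP => x y; rewrite mxE [RHS]mxE.
  rewrite [X in X + _](_ : _ = 0) ?add0r; last first.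
    case: eqP => [ca|_]; last by rewrite mulmx0 mxE.
    rewrite mxE big1 // => l _; rewrite !mxE.
    case: (l =P i) => [->|]; last by rewrite mulr0.
    by rewrite (negPf (has_inN x nii _)) ?mul0r // -s ca.
  case: eqP => [ba|_]; last by rewrite mul0mx mxE.
  rewrite mxE big1 // => l _; rewrite !mxE andbC.
  case: (l =P j) => [->|]; last by rewrite mul0r.
  by rewrite (negPf (has_outN y noj _)) ?mulr0 // s ba.
case=> H _ /(_ a)/matrixP/(_ i j); rewrite eqxx !mxE !eqxx !big1 ?subr0.
- by move=> /eqP; rewrite oner_eq0.
- by move=> l _; rewrite mxE (negPf (has_outN l noi _)) ?mul0r.
- by move=> l _; rewrite mxE (negPf (has_inN l nij _)) ?mulr0.
Qed.

(** A solution [H] would be 1 at [p], constant along the path since the cocycle vanishes on its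
    edges, and 0 at [q]. *)
Lemma bad_chain_not_coboundary p q :
  half_edge (~~ rsgn p.2) p -> connect pair_edge p q -> half_edge (rsgn q.2) q ->
  exists2 D : arrow Q -> 'M[k]_n.+1, mxcocycle I D & ~ mxcoboundary D.
Proof.
move=> hp pq hq; set s := ~~ rsgn p.2; pose E : 'M[k]_n.+1 := delta_mx p.1 p.2.
have EE x y : E x y = ((x, y) == p)%:R by rewrite mxE; case: (p).
have gE : mxgraded E.
  move=> x y; rewrite EE; have [e _|_] := eqVneq (x, y) p; last by rewrite eqxx.
  by have /and4P[/eqP] := hp; rewrite -e.
(* The part of the coboundary of E on the side s: it is a cocycle since both  *)
(* sides of a relation ab have the same sign, sigma b = eps a.                *)
pose D a := (sigma a == s)%:R *: (E *m S a) - (eps a == s)%:R *: (S a *m E).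
have suppZ a (c : k) A : mxsupp (src a) (tgt a) A -> mxsupp (src a) (tgt a) (c *: A).
  by move=> sA x y; rewrite mxE mulf_eq0 negb_or => /andP[_ /sA].
exists D.
  split=> [a|a b e ab].
    apply: mxsuppD; last apply: mxsuppN; apply: suppZ.
      exact: mxsuppMl gE (@sends_mx_supp a).
    exact: mxsuppMr gE (@sends_mx_supp a).
  have SS := sends_mx0 e ab.
  rewrite /D mulmxDr mulmxDl mulmxN mulNmx -!scalemxAr -!scalemxAl.
  rewrite -!mulmxA SS mulmx0 scaler0 add0r [S a *m (S b *m E)]mulmxA SS mul0mx.
  by rewrite scaler0 subr0 (sign_rel signs e ab) subrr.
case=> H _ HD.
have Dij a i j : D a i j =
    (sigma a == s)%:R * (E *m S a) i j - (eps a == s)%:R * (S a *m E) i j.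
  by rewrite !mxE.
have Hij a i j : D a i j = (H *m S a) i j - (S a *m H) i j by rewrite HD !mxE.
have half t i j : half_edge t (i, j) -> H i j = (t == s)%:R * E i j.
  case/and4P=> _ /= noi nij /orP[/has_outP[a [j' [jj' e]]]|/has_inP[a [i' [ii' e]]]].
    have := Hij a i j'; rewrite Dij !(sends_mxr _ _ jj') !sends_mxl0; last 2 first.
    - by move=> l; apply: has_outN e.
    - by move=> l; apply: has_outN e.
    by rewrite mulr0 !subr0 e.
  have := Hij a i' j; rewrite Dij !(sends_mxl _ _ ii') !sends_mxr0; last 2 first.
  - by move=> l; apply: has_inN e.
  - by move=> l; apply: has_inN e.
  by rewrite mulr0 !sub0r e => /oppr_inj.
have edge x y : pair_edge x y -> H x.1 x.2 = H y.1 y.2.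
  move=> xy; have Ey : E y.1 y.2 = 0.
    rewrite EE -surjective_pairing; case: eqP => // e.
    by have := half_edge_left x hp; rewrite -e xy.
  (* An edge leaves [x] on the right side of [x.2], whereas [s] is the left side of [p.2]; the term
     is zero even for [x = p]. *)
  have Ex t : t = rsgn x.2 -> (t == s)%:R * E x.1 x.2 = 0.
    rewrite EE -surjective_pairing => ->.
    have [->|_] := eqVneq x p; last by rewrite mulr0.
    by rewrite /s; case: rsgn; rewrite mul0r.
  case/pair_edgeP: xy => e [a [] [x1 x2]].
    have := Hij a x.1 y.2; rewrite Dij !(sends_mxl _ _ x1) !(sends_mxr _ _ x2).
    rewrite Ey mulr0 subr0 Ex => [/esym/eqP|]; first by rewrite subr_eq0 => /eqP.
    by have [[]|[e']] := sends_sign sorted_w x2 => //; move: e; rewrite e'; lia.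
  have := Hij a y.1 x.2; rewrite Dij !(sends_mxl _ _ x1) !(sends_mxr _ _ x2).
  rewrite Ey mulr0 sub0r Ex => [/esym/eqP|]; first by rewrite oppr0 subr_eq0 => /eqP.
  by have [[e']|[]] := sends_sign sorted_w x2 => //; move: e; rewrite e'; lia.
have Hpq : H p.1 p.2 = H q.1 q.2.
  case/connectP: pq => r pr ->; elim: r (p) pr => //= y r IH x /andP[xy yr].
  by rewrite (edge _ _ xy) IH.
have half_at t x : half_edge t x -> H x.1 x.2 = (t == s)%:R * (x == p)%:R.
  by case: x => i j /half ->; rewrite EE.
have := half_at _ _ hp; rewrite !eqxx mulr1 Hpq (half_at _ _ hq) => /eqP.
(* For [q = p] the two half-edges lie on opposite sides, so the prescribed values are still 1 and
   0. *)
have [->|_] := eqVneq q p; last by rewrite mulr0 eq_sym oner_eq0.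
by rewrite /s; case: rsgn; rewrite mul0r eq_sym oner_eq0.
Qed.

End Matrices.
End PairGraph.

(** * Concatenation and subwords *)

Section Concatenation.
Variables (Q : quiver) (sigma eps : arrow Q -> bool).
Implicit Types (u v w x D E F : word Q) (l : letter Q).
Local Notation sg_start := (sg_start sigma eps).
Local Notation sg_end := (sg_end sigma eps).
Local Notation adj := (adj sigma eps).
Local Notation wsigma := (wsigma sigma eps).
Local Notation weps := (weps sigma eps).
Local Notation wcat := (wcat sigma eps).
Local Notation wcat3 := (wcat3 sigma eps).
Local Notation rsgn := (rsign sigma eps).
Local Notation wsorted w := (sorted adj (letters w)).

Lemma word_eq u v : letters u = letters v -> wstart u = wstart v ->
  wsigma u = wsigma v -> u = v.
Proof.
by case: u v => [y t|l s] [y' t'|l' s'] //=; [move=> _ -> -> | case=> -> ->].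
Qed.

Definition composable u v := (wend u == wstart v) && (wsigma v == ~~ weps u).

Lemma wcat_some u v : composable u v -> exists x, wcat u v = Some x.
Proof.
by rewrite /composable; case: u v => [y t|l s] [y' t'|l' s'] /= c; rewrite ?c; eexists.
Qed.

Record wcat_spec u v x : Prop := WcatSpec {
  wcat_letters : letters x = letters u ++ letters v;
  wcat_start : wstart x = wstart u;
  wcat_end : wend x = wend v;
  wcat_sigma : wsigma x = wsigma u;
  wcat_eps : weps x = weps v }.

Lemma wcatP u v x : wcat u v = Some x -> wcat_spec u v x.
Proof.
case: u v => [y t|l s] [y' t'|l' s'] /=.
- by case: ifP => // /andP[/eqP e /eqP t1] [<-]; split; rewrite /= ?t1 ?e ?negbK.
- by case: ifP => // /andP[/eqP e /eqP t1] [<-]; split; rewrite /= ?t1 ?e ?negbK.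
- case: ifP => // /andP[/eqP e /eqP t1] [<-].
  by split; rewrite /= ?cats0 -?e ?t1 ?negbK.
- by move=> [<-]; split; rewrite //= last_cat.
Qed.

(** [wcat] joins nonempty words without a test, so composability at the joint comes from the product
    being sorted; with a trivial factor it comes from the product being defined. *)
Lemma wcat_sorted u v x : wcat u v = Some x ->
  wsorted x = [&& wsorted u, composable u v & wsorted v].
Proof.
move=> uv; have [-> _ _ _ _] := wcatP uv; move: uv.
case: u v => [y t|l s] [y' t'|l' s'] /=; rewrite /composable /=.
- by case: ifP.
- by case: ifP.
- by case: ifP; rewrite cats0 ?andbT // andbF.
- by rewrite cat_path /= /adj.
Qed.

Lemma wcat3P u v w x : wcat3 u v w = Some x ->
  exists2 y, wcat u v = Some y & wcat y w = Some x.
Proof. by rewrite /wcat3; case: wcat => // y; exists y. Qed.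

Section Positions.
Variables (u v x : word Q).
Hypotheses (uv : wcat u v = Some x) (sx : wsorted x).

Let spec := wcatP uv.
Let comp : composable u v.
Proof. by move: sx; rewrite (wcat_sorted uv) => /and3P[]. Qed.

Lemma wcat_len : wlen x = (wlen u + wlen v)%N.
Proof. by rewrite /wlen (wcat_letters spec) size_cat. Qed.

Lemma wcat_onthr j : onth (letters x) (wlen u + j) = onth (letters v) j.
Proof. by rewrite (wcat_letters spec) onth_cat ltnNge leq_addr /= addKn. Qed.

Lemma wcat_onthl i : (i < wlen u)%N -> onth (letters x) i = onth (letters u) i.
Proof. by move=> iu; rewrite (wcat_letters spec) onth_cat iu. Qed.

Lemma wcat_rsignr j : rsgn x (wlen u + j) = rsgn v j.
Proof. by rewrite /rsign wcat_onthr (wcat_eps spec). Qed.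

Lemma wcat_rsignl i : (i <= wlen u)%N -> rsgn x i = rsgn u i.
Proof.
rewrite leq_eqVlt => /orP[/eqP ->|iu].
  have := wcat_rsignr 0; rewrite addn0 => ->; rewrite rsign0 rsign_end.
  by case/andP: comp => _ /eqP.
rewrite /rsign wcat_onthl //; have [l -> //] : exists l, onth (letters u) i = Some l.
by move: iu; rewrite /wlen -onthTE; case: onth => // l _; exists l.
Qed.

Lemma wcat_vtxl i : (i <= wlen u)%N -> vtx x i = vtx u i.
Proof.
move=> iu; rewrite /vtx (wcat_start spec) (wcat_letters spec) map_cat -cat_cons.
by rewrite nth_cat /= size_map ltnS iu.
Qed.

Lemma wcat_vtxr j : (j <= wlen v)%N -> vtx x (wlen u + j) = vtx v j.
Proof.
case: j => [_|j jv].
  by rewrite addn0 wcat_vtxl // vtx_end; case/andP: comp => /eqP.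
rewrite /vtx (wcat_letters spec) map_cat -cat_cons nth_cat /= size_map ltnS.
rewrite addnS -[size _]/(wlen u) ltnNge leq_addr /= subSS addKn.
by apply: set_nth_default; rewrite size_map.
Qed.

End Positions.

(** * Subwords of a string *)

Section Subwords.
Variable w : word Q.
Hypothesis sorted_w : wsorted w.
Local Notation n := (wlen w).
Local Notation lt := (onth (letters w)).

(** For length zero, the trivial string with the sign of the right side of [i]: the one that
    composes with its neighbours ([wcat_wsub]). *)
Definition wsub i m : word Q :=
  if take m (drop i (letters w)) is l :: s then Word l s
  else Triv (vtx w i) (rsgn w i).

Lemma letters_wsub i m : letters (wsub i m) = take m (drop i (letters w)).
Proof. by rewrite /wsub; case: take. Qed.

Lemma wlen_wsub i m : (i + m <= n)%N -> wlen (wsub i m) = m.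
Proof.
by rewrite /wlen letters_wsub => le; rewrite size_takel // size_drop; lia.
Qed.

Lemma onth_drop (s : seq (letter Q)) i t : onth (drop i s) t = onth s (i + t).
Proof. by elim: s i => [|l s IH] [|i] //=; rewrite !onth0n. Qed.

Lemma onth_take (s : seq (letter Q)) m t : (t < m)%N -> onth (take m s) t = onth s t.
Proof. by elim: s m t => [|l s IH] [|m] [|t] //=; move=> tm; apply: IH. Qed.

Lemma onth_wsub i m t : (t < m)%N -> onth (letters (wsub i m)) t = lt (i + t).
Proof. by move=> tm; rewrite letters_wsub onth_take // onth_drop. Qed.

Lemma wsorted_wsub i m : wsorted (wsub i m).
Proof. by rewrite letters_wsub take_sorted // drop_sorted. Qed.

Lemma wsub_start i m : (i + m <= n)%N -> wstart (wsub i m) = vtx w i.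
Proof.
case: m => [|m] le; first by rewrite /wsub take0.
have := @onth_wsub i m.+1 0 isT; rewrite addn0.
have [l il] : exists l, lt i = Some l.
  have : (i < n)%N by lia.
  by rewrite /wlen -onthTE; case: onth => // l _; exists l.
by rewrite il; case: wsub => //= l' s [->]; rewrite (vtxE sorted_w il).
Qed.

Lemma wsub_sigma i m : (i + m <= n)%N -> wsigma (wsub i m) = rsgn w i.
Proof.
case: m => [|m] le; first by rewrite /wsub take0.
have := @onth_wsub i m.+1 0 isT; rewrite addn0.
have [l il] : exists l, lt i = Some l.
  have : (i < n)%N by lia.
  by rewrite /wlen -onthTE; case: onth => // l _; exists l.
by rewrite il /rsign il; case: wsub => //= l' s [->].
Qed.

Lemma wsub_last i m : (i + m.+1 <= n)%N ->
  exists2 l, lt (i + m) = Some l &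
    wend (wsub i m.+1) = lend l /\ weps (wsub i m.+1) = sg_end l.
Proof.
move=> le; have := @onth_wsub i m.+1 m (ltnSn m).
have := wlen_wsub le; case: wsub => // l' s [ss] <-.
by exists (last l' s) => //; rewrite -ss (last_nth l') onthE (nth_map l').
Qed.

Lemma wsub_end i m : (i + m <= n)%N -> wend (wsub i m) = vtx w (i + m).
Proof.
case: m => [|m] le; first by rewrite /wsub take0 addn0.
by have [l il [-> _]] := wsub_last le; rewrite addnS (vtxS il).
Qed.

Lemma wsub_eps i m : (i + m <= n)%N -> weps (wsub i m) = ~~ rsgn w (i + m).
Proof.
case: m => [|m] le; first by rewrite /wsub take0 addn0.
by have [l il [_ ->]] := wsub_last le; rewrite addnS (rsignS sorted_w il) negbK.
Qed.

Lemma wcat_wsub i m m' : (i + m + m' <= n)%N ->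
  wcat (wsub i m) (wsub (i + m) m') = Some (wsub i (m + m')).
Proof.
move=> le; have le1 : (i + m <= n)%N by lia.
have le2 : (i + (m + m') <= n)%N by lia.
have [|x xE] := @wcat_some (wsub i m) (wsub (i + m) m').
  rewrite /composable wsub_end // wsub_start // wsub_sigma // wsub_eps //.
  by rewrite negbK !eqxx.
have [lx bx _ sx _] := wcatP xE; rewrite xE; congr Some; apply: word_eq.
- by rewrite lx !letters_wsub takeD drop_drop addnC.
- by rewrite bx !wsub_start.
- by rewrite sx !wsub_sigma.
Qed.

Lemma wsub_full : wsub 0 n = w.
Proof.
apply: word_eq.
- by rewrite letters_wsub drop0 take_size.
- by rewrite wsub_start.
- by rewrite wsub_sigma // rsign0.
Qed.

Lemma wcat3_wsub i m : (i + m <= n)%N ->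
  wcat3 (wsub 0 i) (wsub i m) (wsub (i + m) (n - (i + m))) = Some w.
Proof.
move=> le; have := @wcat_wsub 0 i m; have := @wcat_wsub 0 (i + m) (n - (i + m)).
rewrite !add0n subnKC // wsub_full => cat2 cat1.
by rewrite /wcat3 cat1 //= cat2.
Qed.

End Subwords.
End Concatenation.

(** * Ad-pairs as chains *)

Section AdPairs.
Variables (Q : quiver) (sigma eps : arrow Q -> bool) (w : word Q).
Hypothesis sorted_w : sorted (adj sigma eps) (letters w).
Implicit Types D E F : word Q.
Local Notation n := (wlen w).
Local Notation lt := (onth (letters w)).
Local Notation rsgn := (rsign sigma eps w).
Local Notation wsigma := (wsigma sigma eps).
Local Notation weps := (weps sigma eps).
Local Notation snd := (@sends Q w).
Local Notation out := (has_out sigma (w := w)).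
Local Notation inn := (has_in eps (w := w)).
Local Notation pedge := (pair_edge (w := w)).
Local Notation half := (half_edge sigma eps (w := w)).

(* The letter on either side of a position, read away from that position.    *)
Definition left_letter i := if i is i'.+1 then omap (@linv Q) (lt i') else None.
Definition side_letter i s := if rsgn i == s then lt i else left_letter i.

Lemma side_letterP (i : 'I_n.+1) s :
  match side_letter i s with
  | Some l => (out i s = l.1) /\ (inn i s = ~~ l.1)
  | None => ~~ out i s /\ ~~ inn i s
  end.
Proof.
have in_out j : inn j s -> out j s = false.
  move=> h; apply: negbTE; apply/negP => o.
  by have := has_out_inN sorted_w o; rewrite h.
case: (sideP sorted_w i s) => [f|a j h e|a j h e].
- rewrite (_ : side_letter i s = None).
    by move: f; rewrite (side_freeP sorted_w) => /andP.
  case/orP: f => /andP[/eqP ie /eqP r]; rewrite /side_letter r ?eqxx.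
    by rewrite ie onth_default.
  by rewrite ie; case: s {in_out r}.
- have o : out i s by apply/has_outP; exists a, j.
  have -> : side_letter i s = Some (true, a).
    rewrite /side_letter -e; case: (sends_sign sorted_w h) => -[ij l r _].
      by rewrite -r eqxx.
    by rewrite r ij /= l; case: rsgn.
  by rewrite o (negPf (has_out_inN sorted_w o)).
- have o : inn i s by apply/has_inP; exists a, j.
  have -> : side_letter i s = Some (false, a).
    rewrite /side_letter -e; case: (sends_sign sorted_w h) => -[ij l _ r].
      by rewrite r ij /= l; case: rsgn.
    by rewrite -r eqxx.
  by rewrite o in_out.
Qed.

(** This is the substring condition at [i] and the factor string condition at [j], together with the
    failure of one-sidedness at this end. *)
Lemma half_edgeE s i j : half s (i, j) =
  [&& vtx w i == vtx w j, oapp (fun l => ~~ l.1) true (side_letter i s),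
      oapp fst true (side_letter j s) &
      (side_letter i s != None) || (side_letter j s != None)].
Proof.
rewrite /half_edge /=; congr (_ && _).
have := side_letterP i s; have := side_letterP j s.
case: (side_letter i s) => [[d a]|]; case: (side_letter j s) => [[d' a']|] /=.
- by move=> [-> ->] [-> ->]; case: d d' => [] [].
- by move=> [/negPf -> /negPf ->] [-> ->]; case: d.
- by move=> [-> ->] [/negPf -> /negPf ->]; case: d'.
- by move=> [/negPf -> /negPf ->] [/negPf -> /negPf ->].
Qed.

Lemma half_edge_at s (p : 'I_n.+1 * 'I_n.+1) i j :
  p.1 = i :> nat -> p.2 = j :> nat ->
  half s p = [&& vtx w i == vtx w j, oapp (fun l => ~~ l.1) true (side_letter i s),
    oapp fst true (side_letter j s) &
    (side_letter i s != None) || (side_letter j s != None)].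
Proof. by case: p => x y /= <- <-; apply: half_edgeE. Qed.

Lemma side_letter_right i s : rsgn i = s -> side_letter i s = lt i.
Proof. by move=> <-; rewrite /side_letter eqxx. Qed.

Lemma side_letter_left i s : rsgn i = ~~ s -> side_letter i s = left_letter i.
Proof. by rewrite /side_letter => ->; case: s. Qed.

Record factor_spec D E F : Prop := FactorSpec {
  factor_len : (wlen D + wlen E + wlen F = n)%N;
  factor_vtx : forall t, (t <= wlen E)%N -> vtx w (wlen D + t) = vtx E t;
  factor_rsign : forall t, (t <= wlen E)%N ->
    rsgn (wlen D + t) = rsign sigma eps E t;
  factor_onth : forall t, (t < wlen E)%N -> lt (wlen D + t) = onth (letters E) t;
  factor_left : left_letter (wlen D) =
    if letters D is l :: s then Some (linv (last l s)) else None;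
  factor_right : lt (wlen D + wlen E) = onth (letters F) 0 }.

Lemma factorP D E F : wcat3 sigma eps D E F = Some w -> factor_spec D E F.
Proof.
move=> /wcat3P[y DE yF].
have /and3P[sy _ _] : [&& sorted (adj sigma eps) (letters y),
    composable sigma eps y F & sorted (adj sigma eps) (letters F)].
  by rewrite -(wcat_sorted yF).
have ly := wcat_len DE; have lw := wcat_len yF.
split.
- by rewrite lw ly.
- by move=> t tE; rewrite (wcat_vtxl yF) ?ly ?leq_add2l // (wcat_vtxr DE).
- by move=> t tE; rewrite (wcat_rsignl yF) ?ly ?leq_add2l // (wcat_rsignr DE).
- by move=> t tE; rewrite (wcat_onthl yF) ?ly ?ltn_add2l // (wcat_onthr DE).
- case: D DE ly => [//|l s] DE ly; rewrite /left_letter /wlen /=.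
  rewrite (wcat_onthl yF) ?ly /wlen /= ?addSn ?ltnS ?leq_addr //.
  rewrite (wcat_onthl DE) // (last_nth l) -[letters _]/(l :: s).
  have [x xl] : exists x, onth (l :: s) (size s) = Some x.
    by have := ltnSn (size s); rewrite -[X in (_ < X)%N]/(size (l :: s)) -onthTE;
      case: onth => // x; exists x.
  by rewrite xl (onth_nth l _ _ _ xl).
- by rewrite -ly -[wlen y]addn0 (wcat_onthr yF).
Qed.

Lemma lt_sends (x y : 'I_n.+1) d a : lt x = Some (d, a) -> y = x.+1 :> nat ->
  if d then snd a x y else snd a y x.
Proof.
by move=> l e; case: d l => l; apply/sendsP; [left | right].
Qed.

Lemma pair_edge_parallel (x y x' y' : 'I_n.+1) l : lt x = Some l -> lt y = Some l ->
  x' = x.+1 :> nat -> y' = y.+1 :> nat -> pedge (x, y) (x', y').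
Proof.
case: l => d a lx ly ex ey; apply/pair_edgeP; split=> //; exists a.
by have := lt_sends lx ex; have := lt_sends ly ey; case: d {lx ly}; [left|right].
Qed.

Lemma pair_edge_antiparallel (x y x' y' : 'I_n.+1) l : lt x' = Some (linv l) ->
  lt y = Some l -> x = x'.+1 :> nat -> y' = y.+1 :> nat -> pedge (x, y) (x', y').
Proof.
case: l => d a lx ly ex ey; apply/pair_edgeP; split=> //; exists a.
by have := lt_sends lx ex; have := lt_sends ly ey; case: d {lx ly}; [left|right].
Qed.

Lemma connect_walk (T : finType) (e : rel T) (f : nat -> T) m :
  (forall t, (t < m)%N -> e (f t) (f t.+1)) -> connect e (f 0) (f m).
Proof.
elim: m => [|m IH] fe; first exact: connect0.
apply: connect_trans (connect1 (fe m (ltnSn m))).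
by apply: IH => t tm; apply: fe; apply: ltnW.
Qed.

Lemma onth_rev (T : Type) (s : seq T) t : (t < size s)%N ->
  onth (rev s) t = onth s (size s - t.+1).
Proof. by move=> ts; rewrite !onthE map_rev nth_rev ?size_map. Qed.

(** Second positions run through the factor string, first positions through the substring. *)
Definition bad_chain (p q : 'I_n.+1 * 'I_n.+1) :=
  [/\ half (~~ rsgn p.2) p, connect pedge p q & half (rsgn q.2) q].


Lemma ends_directE D E F : factor_spec D E F ->
  ends_direct D = oapp (fun l => ~~ l.1) true (left_letter (wlen D)).
Proof. by move=> sp; rewrite (factor_left sp); case: (D) => //= l s; rewrite negbK. Qed.

Lemma ends_inverseE D E F : factor_spec D E F ->
  ends_inverse D = oapp fst true (left_letter (wlen D)).
Proof. by move=> sp; rewrite (factor_left sp); case: (D). Qed.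

Lemma left_letterE D E F : factor_spec D E F ->
  (left_letter (wlen D) != None) = (wlen D != 0).
Proof. by move=> sp; rewrite (factor_left sp); case: (D). Qed.

Lemma starts_directE D E F : factor_spec D E F ->
  starts_direct F = oapp fst true (lt (wlen D + wlen E)).
Proof. by move=> sp; rewrite (factor_right sp); case: (F). Qed.

Lemma starts_inverseE D E F : factor_spec D E F ->
  starts_inverse F = oapp (fun l => ~~ l.1) true (lt (wlen D + wlen E)).
Proof. by move=> sp; rewrite (factor_right sp); case: (F). Qed.

Lemma right_letterE D E F : factor_spec D E F ->
  (lt (wlen D + wlen E) != None) = (wlen F != 0).
Proof. by move=> sp; rewrite (factor_right sp); case: (F). Qed.

Variables (k : fieldType) (I : path_algebra Q k -> Prop).

(** Walking simultaneously along [E] and [E'] is a path in the pair graph. The letters next to [E]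
    and [E'] make its ends half-edges, unless both are missing at the same end. *)
Lemma one_sided_or_bad_chain D E F D' E' F' :
  ad_pair I sigma eps w w D E F D' E' F' ->
  one_sided D E F D' E' F' \/ exists p q, bad_chain p q.
Proof.
case=> [[[_ _ _ /factorP sp] eD sF] [[_ _ _ /factorP sp'] eD' sF'] EE'].
have le : (wlen D + wlen E <= n)%N by rewrite -(factor_len sp) leq_addr.
have le' : (wlen D' + wlen E' <= n)%N by rewrite -(factor_len sp') leq_addr.
have r0 := factor_rsign sp (leq0n _); rewrite addn0 rsign0 in r0.
have r0' := factor_rsign sp' (leq0n _); rewrite addn0 rsign0 in r0'.
have r1 := factor_rsign sp (leqnn _); rewrite rsign_end in r1.
have r1' := factor_rsign sp' (leqnn _); rewrite rsign_end in r1'.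
have v0 := factor_vtx sp (leq0n _); rewrite addn0 vtx0 in v0.
have v0' := factor_vtx sp' (leq0n _); rewrite addn0 vtx0 in v0'.
have v1 := factor_vtx sp (leqnn _); rewrite vtx_end in v1.
have v1' := factor_vtx sp' (leqnn _); rewrite vtx_end in v1'.
rewrite (ends_inverseE sp) in eD; rewrite (starts_directE sp) in sF.
rewrite (ends_directE sp') in eD'; rewrite (starts_inverseE sp') in sF'.
case: EE' => e.
- have [/andP[/eqP z' /eqP z]|c0] := boolP ((wlen D' == 0) && (wlen D == 0)).
    by left; left; split=> //; left.
  have [/andP[/eqP z' /eqP z]|c1] := boolP ((wlen F' == 0) && (wlen F == 0)).
    by left; left; split=> //; right.
  right; subst E'; pose m := wlen E.
  pose f t : 'I_n.+1 * 'I_n.+1 := (inord (wlen D' + t), inord (wlen D + t)).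
  have f1 t : (t <= m)%N -> (f t).1 = (wlen D' + t)%N :> nat.
    by move=> tm; apply: inordK; rewrite ltnS (leq_trans _ le') // leq_add2l.
  have f2 t : (t <= m)%N -> (f t).2 = (wlen D + t)%N :> nat.
    by move=> tm; apply: inordK; rewrite ltnS (leq_trans _ le) // leq_add2l.
  exists (f 0), (f m); split.
  + rewrite (half_edge_at _ (f1 _ (leq0n _)) (f2 _ (leq0n _))) f2 // !addn0.
    rewrite !side_letter_left ?negbK ?r0 ?r0' // v0 v0' eqxx eD eD' /=.
    by rewrite (left_letterE sp) (left_letterE sp') -negb_and.
  + apply: connect_walk => t tm.
    have [l El] : exists l, onth (letters E) t = Some l.
      by move: tm; rewrite /m /wlen -onthTE; case: onth => // l _; exists l.
    apply: (@pair_edge_parallel _ _ _ _ l).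
    * by rewrite f1 ?(factor_onth sp') // ltnW.
    * by rewrite f2 ?(factor_onth sp) // ltnW.
    * by rewrite !f1 ?addnS // ltnW.
    * by rewrite !f2 ?addnS // ltnW.
  + rewrite (half_edge_at _ (f1 _ (leqnn _)) (f2 _ (leqnn _))) f2 //.
    rewrite !side_letter_right /m ?r1 ?r1' // v1 v1' eqxx sF sF' /=.
    by rewrite (right_letterE sp) (right_letterE sp') -negb_and.
- have [/andP[/eqP z' /eqP z]|c0] := boolP ((wlen F' == 0) && (wlen D == 0)).
    by left; right; split=> //; left.
  have [/andP[/eqP z' /eqP z]|c1] := boolP ((wlen D' == 0) && (wlen F == 0)).
    by left; right; split=> //; right.
  right; have mE : wlen E' = wlen E by rewrite -e wlen_winv.
  pose m := wlen E.
  (* [E'] is the inverse of [E], so it is traversed from its right end. *)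
  pose f t : 'I_n.+1 * 'I_n.+1 := (inord (wlen D' + (m - t)), inord (wlen D + t)).
  have f1 t : (t <= m)%N -> (f t).1 = (wlen D' + (m - t))%N :> nat.
    move=> tm; apply: inordK; rewrite ltnS (leq_trans _ le') // leq_add2l mE.
    exact: leq_subr.
  have f2 t : (t <= m)%N -> (f t).2 = (wlen D + t)%N :> nat.
    by move=> tm; apply: inordK; rewrite ltnS (leq_trans _ le) // leq_add2l.
  have ve : wend E' = wstart E by rewrite -e wend_winv.
  have vs : wstart E' = wend E by rewrite -e wstart_winv.
  have se : weps E' = wsigma E by rewrite -e weps_winv.
  have ss : wsigma E' = weps E by rewrite -e wsigma_winv.
  exists (f 0), (f m); split.
  + rewrite (half_edge_at _ (f1 _ (leq0n _)) (f2 _ (leq0n _))) f2 // !addn0 subn0.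
    rewrite /m -mE (@side_letter_left (wlen D)) ?negbK // side_letter_right; last first.
      by rewrite r1' r0 se.
    rewrite v0 v1' ve eqxx eD sF' /=.
    by rewrite (left_letterE sp) (right_letterE sp') -negb_and.
  + apply: connect_walk => t tm.
    have [l El] : exists l, onth (letters E) t = Some l.
      by move: tm; rewrite /m /wlen -onthTE; case: onth => // l _; exists l.
    apply: (@pair_edge_antiparallel _ _ _ _ l).
    * have mt : (m - t.+1 < m)%N by rewrite ltn_subrL (leq_ltn_trans _ tm).
      rewrite f1 // (factor_onth sp') ?mE // -e letters_winv onth_map onth_rev //.
      by rewrite -/(wlen E) -/m subnSK // subKn ?El // ltnW.
    * by rewrite f2 ?(factor_onth sp) // ltnW.
    * by rewrite !f1 ?(ltnW tm) // -addnS subnSK.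
    * by rewrite !f2 ?addnS // ltnW.
  + rewrite (half_edge_at _ (f1 _ (leqnn _)) (f2 _ (leqnn _))) f2 // subnn addn0.
    rewrite (@side_letter_right (wlen D + m)) // side_letter_left; last first.
      by rewrite r1 r0' ss negbK.
    rewrite v1 v0' vs eqxx sF eD' /=.
    by rewrite (right_letterE sp) (left_letterE sp') -negb_and.
Qed.

Variant edge_spec (p q : 'I_n.+1 * 'I_n.+1) : Prop :=
| EdgeParallel l of lt p.2 = Some l & q.2 = p.2.+1 :> nat &
    rsgn p.1 = rsgn p.2 & q.1 = p.1.+1 :> nat & lt p.1 = Some l &
    rsgn q.1 = rsgn q.2
| EdgeAntiparallel l of lt p.2 = Some l & q.2 = p.2.+1 :> nat &
    rsgn p.1 = ~~ rsgn p.2 & p.1 = q.1.+1 :> nat & lt q.1 = Some (linv l) &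
    rsgn q.1 = ~~ rsgn q.2.

Lemma edgeP p q : pedge p q -> edge_spec p q.
Proof.
case/pair_edgeP=> e [a [] [s1 s2]].
- case: (sends_sign sorted_w s2) => -[e2 l2 r2 r2']; last by rewrite e2 in e; lia.
  case: (sends_sign sorted_w s1) => -[e1 l1 r1 r1'].
    apply: (EdgeParallel l2) => //; first by rewrite -r1.
    by apply: negb_inj; rewrite -r1'.
  apply: (EdgeAntiparallel l2) => //; last by rewrite -r1'.
  by apply: negb_inj; rewrite negbK -r1.
- case: (sends_sign sorted_w s2) => -[e2 l2 r2 r2']; first by rewrite e2 in e; lia.
  case: (sends_sign sorted_w s1) => -[e1 l1 r1 r1'].
    apply: (EdgeAntiparallel l2) => //; last by rewrite -r1.
    by apply: negb_inj; rewrite negbK -r1'.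
  apply: (EdgeParallel l2) => //; first by rewrite -r1'.
  by apply: negb_inj; rewrite -r1.
Qed.

Variant chain_spec (p q : 'I_n.+1 * 'I_n.+1) : Prop :=
| ChainParallel m of q.2 = (p.2 + m)%N :> nat &
    rsgn p.1 = rsgn p.2 & q.1 = (p.1 + m)%N :> nat & rsgn q.1 = rsgn q.2 &
    forall t, (t < m)%N -> lt (p.1 + t) = lt (p.2 + t)
| ChainAntiparallel m of q.2 = (p.2 + m)%N :> nat &
    rsgn p.1 = ~~ rsgn p.2 & p.1 = (q.1 + m)%N :> nat & rsgn q.1 = ~~ rsgn q.2 &
    forall t, (t < m)%N -> lt (q.1 + (m - t.+1)) = omap (@linv Q) (lt (p.2 + t)).

(** Each edge preserves whether the right-hand signs of the two positions agree, so a chain cannot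
    switch between parallel and antiparallel. For a chain without edges the signs alone choose the
    case. *)
Lemma chainP p q : connect pedge p q -> chain_spec p q.
Proof.
case/connectP=> s; elim: s p => [|y s IH] p /=.
  move=> _ ->; have [r|r] := eqVneq (rsgn p.1) (rsgn p.2).
    by apply: (@ChainParallel _ _ 0); rewrite ?addn0.
  have {}r : rsgn p.1 = ~~ rsgn p.2 by move: r; case: (rsgn p.1); case: (rsgn p.2).
  by apply: (@ChainAntiparallel _ _ 0); rewrite ?addn0.
case/andP=> /edgeP py ys qe; case: (IH y ys qe) => m e2 r1 e1 r2 ltE.
- case: py => l l2 e r e' l1 r'; last by rewrite r' in r1; case: rsgn r1.
  apply: (@ChainParallel _ _ m.+1) => //.
  + by rewrite e2 e addSnnS.
  + by rewrite e1 e' addSnnS.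
  + case=> [|t] tm; first by rewrite !addn0 l1 l2.
    by rewrite -!addSnnS -e -e' ltE.
- case: py => l l2 e r e' l1 r'; first by rewrite r' in r1; case: rsgn r1.
  apply: (@ChainAntiparallel _ _ m.+1) => //.
  + by rewrite e2 e addSnnS.
  + by rewrite e' e1 addnS.
  + case=> [|t] tm; first by rewrite subn1 addn0 l2 -e1 l1.
    by rewrite subSS -addSnnS -e ltE.
Qed.

Hypothesis I2 : exists2 P : qpath Q -> Prop,
    (forall p, P p -> size (parrows p) = 2%N) &
    (forall f, I f <-> ideal_generated_by P f).
Hypothesis signs : sign_functions I sigma eps.

(* The middle letter would be its own inverse, or the two middle letters     *)
(* would be inverse to each other.                                           *)
Lemma winv_neq E : sorted (adj sigma eps) (letters E) -> winv E <> E.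
Proof.
move=> sE e; have lE := letters_winv E; rewrite e in lE.
have E0 : (0 < wlen E)%N.
  by rewrite /wlen; case: (E) e => //= x t [] ; case: t.
have onthE t : (t < wlen E)%N ->
    onth (letters E) t = omap (@linv Q) (onth (letters E) (wlen E - t.+1)).
  by move=> tE; rewrite {1}lE onth_map onth_rev.
have hE : ((wlen E)./2 < wlen E)%N by lia.
have [l mid] : exists l, onth (letters E) (wlen E)./2 = Some l.
  by move: hE; rewrite [X in (_ < X)%N]/wlen -onthTE; case: onth => // l _; exists l.
have := onthE _ hE; rewrite mid; have := odd_double_half (wlen E).
case: (odd _) => eE.
  rewrite (_ : wlen E - _ = (wlen E)./2)%N; last by lia.
  by rewrite mid => -[] /esym/linv_neq.
have h1 : (wlen E)./2 = (wlen E - (wlen E)./2.+1).+1 by lia.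
case prev: (onth _ _) => [l'|] //= [ll]; rewrite h1 in mid.
have /andP[_ /eqP] := sorted_onth sE prev mid.
by rewrite ll sg_start_linv; case: sg_end.
Qed.

(** The positions visited delimit [E] and [E'], and the half-edges supply a letter at each end, so
    the pair is not one-sided in its own orientation. The other orientation would make [E] its own
    inverse, against [winv_neq]. *)
Lemma ad_pair_of_bad_chain p q : bad_chain p q ->
  exists D E F D' E' F', ad_pair I sigma eps w w D E F D' E' F' /\
    ~ one_sided D E F D' E' F'.
Proof.
case=> hp /chainP pq hq.
have stringP i m : is_string I (wsub sigma eps w i m).
  by apply/(is_stringP I2 signs); apply: wsorted_wsub.
have bound (i : 'I_n.+1) : (i <= n)%N by rewrite -ltnS.
have dec i m : (i + m <= n)%N -> decomposition I sigma eps w (wsub sigma eps w 0 i)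
    (wsub sigma eps w i m) (wsub sigma eps w (i + m) (n - (i + m))).
  by move=> le; split=> //; apply: wcat3_wsub.
have spec i m (le : (i + m <= n)%N) := factorP (wcat3_wsub sorted_w le).
case: p q hp hq pq => [i0 j0] [i1 j1] hp hq.
rewrite /= !half_edgeE // in hp hq.
case=> m /= e2 r1 e1 r2 ltE.
- have lej : (j0 + m <= n)%N by rewrite -e2.
  have lei : (i0 + m <= n)%N by rewrite -e1.
  have := spec _ _ lej; have := spec _ _ lei; have := dec _ _ lej; have := dec _ _ lei.
  set D := wsub _ _ _ 0 j0; set E := wsub _ _ _ j0 m; set F := wsub _ _ _ (j0 + m) _.
  set D' := wsub _ _ _ 0 i0; set E' := wsub _ _ _ i0 m; set F' := wsub _ _ _ (i0 + m) _.
  move=> dE' dE sp' sp.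
  have lenD : wlen D = j0 by rewrite wlen_wsub ?add0n ?bound.
  have lenD' : wlen D' = i0 by rewrite wlen_wsub ?add0n ?bound.
  have lenE : wlen E = m by rewrite wlen_wsub ?add0n ?bound.
  have lenE' : wlen E' = m by rewrite wlen_wsub ?add0n ?bound.
  have lD := ends_inverseE sp; have lD' := ends_directE sp'.
  have lF := starts_directE sp; have lF' := starts_inverseE sp'.
  have nD := left_letterE sp; have nD' := left_letterE sp'.
  have nF := right_letterE sp; have nF' := right_letterE sp'.
  rewrite lenD ?lenD' ?lenE ?lenE' in lD lD' lF lF' nD nD' nF nF'.
  move: hp hq; rewrite (@side_letter_left j0) ?negbK //.
  rewrite (@side_letter_left i0) ?negbK //.
  rewrite (@side_letter_right i1) // (@side_letter_right j1) // e1 e2.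
  case/and4P=> /eqP vp lp lp' np /and4P[/eqP vq lq lq' nq].
  have EE : E = E'.
    apply: (@word_eq Q sigma eps).
    - apply: eq_from_onth_le => t; rewrite -!/(wlen _) lenE lenE' maxnn => tm.
      by rewrite !onth_wsub // ltE.
    - by rewrite !wsub_start // vp.
    - by rewrite !wsub_sigma // r1.
  exists D, E, F, D', E', F'; split.
    split; last by left.
    - by split=> //; rewrite ?lD ?lF.
    - by split=> //; rewrite ?lD' ?lF'.
  case=> [[_ []]|[iE _]].
  - by case=> z z'; move: np; rewrite nD nD' -lenD -lenD' z z'.
  - by case=> z z'; move: nq; rewrite nF nF' z z'.
  - by apply: (@winv_neq E); [apply: wsorted_wsub | rewrite iE].
- have lej : (j0 + m <= n)%N by rewrite -e2.
  have lei : (i1 + m <= n)%N by rewrite -e1.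
  have := spec _ _ lej; have := spec _ _ lei; have := dec _ _ lej; have := dec _ _ lei.
  set D := wsub _ _ _ 0 j0; set E := wsub _ _ _ j0 m; set F := wsub _ _ _ (j0 + m) _.
  set D' := wsub _ _ _ 0 i1; set E' := wsub _ _ _ i1 m; set F' := wsub _ _ _ (i1 + m) _.
  move=> dE' dE sp' sp.
  have lenD : wlen D = j0 by rewrite wlen_wsub ?add0n ?bound.
  have lenD' : wlen D' = i1 by rewrite wlen_wsub ?add0n ?bound.
  have lenE : wlen E = m by rewrite wlen_wsub ?add0n ?bound.
  have lenE' : wlen E' = m by rewrite wlen_wsub ?add0n ?bound.
  have lD := ends_inverseE sp; have lD' := ends_directE sp'.
  have lF := starts_directE sp; have lF' := starts_inverseE sp'.
  have nD := left_letterE sp; have nD' := left_letterE sp'.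
  have nF := right_letterE sp; have nF' := right_letterE sp'.
  rewrite lenD ?lenD' ?lenE ?lenE' in lD lD' lF lF' nD nD' nF nF'.
  move: hp hq; rewrite (@side_letter_left j0) ?negbK //.
  rewrite (@side_letter_right i0) // (@side_letter_left i1) //.
  rewrite (@side_letter_right j1) // e1 e2.
  case/and4P=> /eqP vp lp lp' np /and4P[/eqP vq lq lq' nq].
  have EE : winv E = E'.
    apply: (@word_eq Q sigma eps).
    - apply: eq_from_onth_le => t; rewrite -!/(wlen _) wlen_winv lenE lenE' maxnn => tm.
      rewrite letters_winv onth_map onth_rev; last by rewrite -/(wlen E) lenE.
      have mt : (m - t.+1 < m)%N by rewrite ltn_subrL (leq_ltn_trans _ tm).
      rewrite -/(wlen E) lenE !onth_wsub // -ltE // subnSK // subKn //.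
      exact: ltnW.
    - by rewrite wstart_winv wsub_end // wsub_start // vq.
    - by rewrite wsigma_winv wsub_eps // wsub_sigma // r2 e2.
  exists D, E, F, D', E', F'; split.
    split; last by right.
    - by split=> //; rewrite ?lD ?lF.
    - by split=> //; rewrite ?lD' ?lF'.
  case=> [[iE _]|[_ []]].
  - by apply: (@winv_neq E); [apply: wsorted_wsub | rewrite EE].
  - by case=> z z'; move: np; rewrite nD nF' -lenD z z'.
  - by case=> z z'; move: nq; rewrite nF nD' -lenD' z z'.
Qed.

End AdPairs.

(** * Arrow extensions as isolated coordinates *)

Section ArrowExtensions.
Variables (Q : quiver) (sigma eps : arrow Q -> bool).
Variables (k : fieldType) (I : path_algebra Q k -> Prop).
Hypothesis I2 : exists2 P : qpath Q -> Prop,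
    (forall p, P p -> size (parrows p) = 2%N) &
    (forall f, I f <-> ideal_generated_by P f).
Hypothesis signs : sign_functions I sigma eps.
Local Notation comp := (composable sigma eps).

Lemma composable_winv (u v : word Q) : comp (winv v) (winv u) = comp u v.
Proof.
rewrite /composable wend_winv wstart_winv wsigma_winv weps_winv eq_sym.
by congr (_ && _); case: wsigma; case: weps.
Qed.

(** By [is_stringP] being a string is local, so only the two joints matter. *)
Lemma cat3_stringP (u x v : word Q) : is_string I u -> is_string I x ->
  is_string I v ->
  cat3_string I sigma eps u x v <-> comp u x && comp x v.
Proof.
move=> /(is_stringP I2 signs) su /(is_stringP I2 signs) sx.
move=> /(is_stringP I2 signs) sv; split.
  case=> z /wcat3P[y ux yv] /(is_stringP I2 signs).
  rewrite (wcat_sorted yv) (wcat_sorted ux) => /and3P[/and3P[_ -> _] yv' _] /=.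
  by move: yv'; rewrite /composable (wcat_end (wcatP ux)) (wcat_eps (wcatP ux)).
case/andP=> ux xv; have [y uy] := wcat_some ux.
have yv : comp y v.
  by move: xv; rewrite /composable (wcat_end (wcatP uy)) (wcat_eps (wcatP uy)).
have [z yz] := wcat_some yv; exists z; first by rewrite /wcat3 uy /= yz.
apply/(is_stringP I2 signs).
by rewrite (wcat_sorted yz) (wcat_sorted uy) su ux sx yv sv.
Qed.

Variable w : word Q.
Hypothesis string_w : is_string I w.
Local Notation vt := (vtx w).
Local Notation n := (wlen w).

Let sorted_w : sorted (adj sigma eps) (letters w).
Proof. exact/(is_stringP I2 signs). Qed.

Lemma is_string_winv : is_string I (winv w).
Proof.
by apply/(is_stringP I2 signs); rewrite letters_winv sorted_adj_linv.
Qed.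

Lemma is_string_letter (l : letter Q) : is_string I (Word l [::]).
Proof. exact/(is_stringP I2 signs). Qed.

(** A free side occurs only at an end of [w], and the left end of [w] is the right end of its
    inverse. *)
Lemma free_start a :
  (exists i : 'I_n.+1, vt i = src a /\ side_free sigma eps i (sigma a)) <->
  comp w (warrow a) || comp (winv w) (warrow a).
Proof.
rewrite /composable /= wend_winv weps_winv -vtx_end -vtx0 -rsign0.
have -> : weps sigma eps w = ~~ rsign sigma eps w n by rewrite rsign_end negbK.
split.
  case=> i [vi /orP[]/andP[/eqP ie /eqP r]]; rewrite ie in vi r.
    by rewrite vi -r negbK !eqxx.
  by rewrite vi r !negbK !eqxx orbT.
case/orP=> /andP[/eqP v /eqP r].
  by exists ord_max; split=> //; rewrite /side_free r negbK !eqxx.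
by exists ord0; split=> //; rewrite /side_free /= r negbK !eqxx orbT.
Qed.

Lemma free_end a :
  (exists j : 'I_n.+1, vt j = tgt a /\ side_free sigma eps j (eps a)) <->
  comp (warrow a) w || comp (warrow a) (winv w).
Proof.
rewrite /composable /= wstart_winv wsigma_winv -vtx_end -vtx0 -rsign0.
have -> : weps sigma eps w = ~~ rsign sigma eps w n by rewrite rsign_end negbK.
split.
  case=> j [vj /orP[]/andP[/eqP je /eqP r]]; rewrite je in vj r.
    by rewrite vj r !eqxx /= orbT.
  by rewrite vj r !eqxx.
case/orP=> /andP[/eqP v /eqP r].
  by exists ord0; split=> //; rewrite /side_free /= r !eqxx orbT.
by exists ord_max; split=> //; rewrite /side_free /= (negb_inj r) !eqxx.
Qed.

(** The arrow leaves an end of [w] and arrives at an end of [w]; the four choices of ends are the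
    four words. *)
Lemma isolatedP : (exists a i j, isolated sigma eps (w := w) a i j) <->
  (exists a, cat3_string I sigma eps w (warrow a) w \/
             cat3_string I sigma eps w (warrow a) (winv w)) \/
  (exists b, cat3_string I sigma eps (winv w) (warrow b) w \/
             cat3_string I sigma eps (winv w) (warrow b) (winv w)).
Proof.
have sv := is_string_winv; have sl a : is_string I (warrow a) := is_string_letter _.
split.
  case=> a [i [j /and4P[/eqP vi /eqP vj fi fj]]].
  have /free_start/orP ci : exists i : 'I_n.+1, vt i = src a /\
    side_free sigma eps i (sigma a) by exists i.
  have /free_end/orP cj : exists j : 'I_n.+1, vt j = tgt a /\
    side_free sigma eps j (eps a) by exists j.
  case: ci => ci; [left | right]; exists a; case: cj => cj; [left|right|left|right];
    by apply/cat3_stringP; rewrite ?ci ?cj.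
have iso a : comp w (warrow a) || comp (winv w) (warrow a) ->
    comp (warrow a) w || comp (warrow a) (winv w) ->
    exists a i j, isolated sigma eps (w := w) a i j.
  move=> /free_start[i [vi fi]] /free_end[j [vj fj]]; exists a, i, j.
  by rewrite /isolated vi vj !eqxx fi fj.
case=> -[a []].
- move/(cat3_stringP string_w (sl a) string_w)/andP=> [c c'].
  by apply: (iso a); rewrite ?c ?c'.
- move/(cat3_stringP string_w (sl a) sv)/andP=> [c c'].
  by apply: (iso a); rewrite ?c ?c' ?orbT.
- move/(cat3_stringP sv (sl a) string_w)/andP=> [c c'].
  by apply: (iso a); rewrite ?c ?c' ?orbT.
- move/(cat3_stringP sv (sl a) sv)/andP=> [c c'].
  by apply: (iso a); rewrite ?c ?c' ?orbT.
Qed.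

(** Inversion of the products: $(w b^{-1} w)^{-1} = w^{-1} b w^{-1}$ and $(w^{-1} b^{-1} w)^{-1} =
    w^{-1} b w$. *)
Lemma inverse_arrowP :
  (exists b, cat3_string I sigma eps w (warrow_inv b) w \/
             cat3_string I sigma eps (winv w) (warrow_inv b) w) <->
  (exists b, cat3_string I sigma eps (winv w) (warrow b) w \/
             cat3_string I sigma eps (winv w) (warrow b) (winv w)).
Proof.
have sv := is_string_winv; have sl a : is_string I (warrow a) := is_string_letter _.
have si a : is_string I (warrow_inv a) := is_string_letter _.
have swap1 b : cat3_string I sigma eps w (warrow_inv b) w <->
    cat3_string I sigma eps (winv w) (warrow b) (winv w).
  rewrite !cat3_stringP // andbC.
  by rewrite -(composable_winv w) -(composable_winv _ w).
have swap2 b : cat3_string I sigma eps (winv w) (warrow_inv b) w <->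
    cat3_string I sigma eps (winv w) (warrow b) w.
  rewrite !cat3_stringP // andbC.
  by rewrite -(composable_winv (winv w)) -(composable_winv _ w) winvK.
split=> -[b [h|h]]; exists b.
- by right; apply/swap1.
- by left; apply/swap2.
- by right; apply/swap2.
- by left; apply/swap1.
Qed.

Lemma exceptional_string_module :
  exceptional I (string_module k w) <->
  ~ (exists a i j, isolated sigma eps (w := w) a i j) /\
  ~ (exists p q, @bad_chain Q sigma eps w p q).
Proof.
rewrite (exceptional_mxP (@sends_mx_supp _ _ _ _ sorted_w k) I2
  (sends_mx0 sorted_w signs)); split=> [H|[niso nbad] D DI].
  split.
    case=> a [i [j iso]].
    have [D DI nD] := isolated_not_coboundary sorted_w signs iso.
    exact: nD (H D DI).
  case=> p [q [hp pq hq]].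
  have [D DI nD] := bad_chain_not_coboundary sorted_w signs hp pq hq.
  exact: nD (H D DI).
apply: (mxcocycle_coboundary sorted_w signs _ _ DI) => [a i j vi vj fi|p q hp pq].
  apply/negP => fj; apply: niso; exists a, i, j.
  by rewrite /isolated vi vj !eqxx fi fj.
by apply/negP => hq; apply: nbad; exists p, q.
Qed.

End ArrowExtensions.

(** * The criterion in terms of strings *)

Theorem corollary2p6 (k : closedFieldType) (Q : quiver)
  (I : path_algebra Q k -> Prop) (sigma eps : arrow Q -> bool)
  (gentleI : gentle I) (signs : sign_functions I sigma eps)
  (w : word Q) (string_w : is_string I w) :
  (exceptional I (string_module k w) <->
     ~ has_self_extensions I sigma eps w) /\
  (exceptional I (string_module k w) <->
     [/\ ~ (exists a : arrow Q,
              cat3_string I sigma eps w (warrow a) w \/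
              cat3_string I sigma eps w (warrow a) (winv w)),
         ~ (exists b : arrow Q,
              cat3_string I sigma eps w (warrow_inv b) w \/
              cat3_string I sigma eps (winv w) (warrow_inv b) w) &
         forall D E F D' E' F' : word Q,
           ad_pair I sigma eps w w D E F D' E' F' ->
           one_sided D E F D' E' F']).
Proof.
have I2 := gentle_length2 gentleI.
have sw : sorted (adj sigma eps) (letters w) by apply/(is_stringP I2 signs).
have exc := exceptional_string_module I2 signs string_w.
have iso := isolatedP I2 signs string_w.
have inv := inverse_arrowP I2 signs string_w.
(* One-sidedness is reached without double negation, since tests on lengths decide between it and a
   bad chain. *)
have one D E F D' E' F' : exceptional I (string_module k w) ->
    ad_pair I sigma eps w w D E F D' E' F' -> one_sided D E F D' E' F'.
  move=> /exc[_ nbad] /(one_sided_or_bad_chain sw)[//|bad].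
  by case: nbad.
have crit : ~ (exists a i j, isolated sigma eps (w := w) a i j) ->
    ~ (exists D E F D' E' F', ad_pair I sigma eps w w D E F D' E' F' /\
       ~ one_sided D E F D' E' F') -> exceptional I (string_module k w).
  move=> niso nad; apply/exc; split=> // -[p [q bad]]; apply: nad.
  exact: (ad_pair_of_bad_chain sw I2 signs bad).
split; split.
- move=> ex; have [niso _] := exc.1 ex.
  case=> [E1|E2|[D [E [F [D' [E' [F' [ad]]]]]]]]; last by apply; apply: one ad.
  + by apply: niso; apply/iso; left.
  + by apply: niso; apply/iso; right.
- move=> nse; apply: crit => [/iso[]|] h; apply: nse.
  + by constructor 1.
  + by constructor 2.
  + by constructor 3.
- move=> ex; have [niso _] := exc.1 ex; split.
  + by move=> h; apply: niso; apply/iso; left.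
  + by move=> /inv h; apply: niso; apply/iso; right.
  + by move=> D E F D' E' F'; apply: one.
- case=> n1 n2 n3; apply: crit.
    by move=> /iso[//|/inv].
  by case=> D [E [F [D' [E' [F' [/n3]]]]]].
Qed.
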